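(* Let $D=\rho/\kappa$ be a skew diagram that is a sum of fat staircases, i.e. $s_D=\sum_{\nu} c_{\kappa\nu}^{\rho}s_\nu$ where the sum runs only over partitions $\nu$ that are fat staircases (equivalently $c_{\kappa\nu}^{\rho}=0$ whenever $\nu$ is not a fat staircase). Then for all partitions $\lambda,\mu$ with $\mu\subseteq\lambda$ and every integer $k\ge 0$ such that $\lambda_1-\mu_1-k\le$ the length of the last row of $D$, we have $$ s_{\mathcal{S}(\lambda,\mu,D;k)}\;\le_s\;\sum_{\nu} c_{\kappa\nu}^{\rho}\, s_{\mathcal{S}(\lambda,\mu,\alpha(\nu)^{\triangleleft};k)},$$ where the sum is over fat staircase partitions $\nu$.
   Context: Diagrams are drawn in English notation (rows indexed top to bottom, columns left to right); a diagram is a Ferrers diagram of a partition or a skew diagram $\rho/\kappa$; $s_D$ is the (skew) Schur function of $D$, and $c_{\kappa\nu}^{\rho}$ are the Littlewood-Richardson coefficients, so $s_{\rho/\kappa}=\sum_\nu c_{\kappa\nu}^\rho s_\nu$. For symmetric functions $f,g$, write $f\le_s g$ if $g-f$ is Schur-positive (all coefficients in the Schur basis are nonnegative). A composition $\alpha=(\alpha_1,\dots,\alpha_n)$ is a finite sequence of positive integers; $l(\alpha)=n$. Put $\delta_\alpha=(n^{\alpha_n},(n-1)^{\alpha_{n-1}},\dots,1^{\alpha_1})$, the partition with exactly $\alpha_i$ parts equal to $i$ for each $i$, and let $\Delta_\alpha$ be the $180^\circ$ rotation of $\delta_\alpha$. A partition $\nu$ is a fat staircase if $\nu=\delta_\alpha$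 for some composition $\alpha$; then $\alpha(\nu)$ denotes this $\alpha$, i.e. $\alpha(\nu)_i$ is the number of parts of $\nu$ equal to $i$. For a skew diagram $D$, partitions $\mu\subseteq\lambda$ and $k\ge0$ with $\lambda_1-\mu_1-k\le$ the length of the last (bottom) row of $D$, $\mathcal{S}(\lambda,\mu,D;k)$ is the skew diagram obtained by placing $\lambda/\mu$ immediately below $D$ so that the first row of $\lambda/\mu$ begins one row below and $k$ columns to the left of the bottom-left box of $D$ (so that the last row of $D$ and the first row of $\lambda/\mu$ overlap in $\lambda_1-\mu_1-k$ columns). Explicitly, if the bottom-left box of $D$ is in row $r$, column $c$, then box $(i,j)$ of $\lambda/\mu$ is placed at row $r+i$, column $c-k+j-\mu_1-1$. For a composition $\alpha$, $\mathcal{S}(\lambda,\mu,\alpha^{\triangleleft};k)$ means $\mathcal{S}(\lambda,\mu,\Delta_\alpha;k)$ (defined when $\lambda_1-\mu_1-k\le l(\alpha)$). *)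

(* Defs.v *)
From HB Require Import structures.
From mathcomp Require Import all_boot all_order all_algebra.
From mathcomp Require Import finmap mpoly zify.

Set Implicit Arguments.
Unset Strict Implicit.
Unset Printing Implicit Defensive.

Import Order.TTheory GRing.Theory Num.Theory.

Local Open Scope fset_scope.
Local Open Scope ring_scope.

(* Partitions are weakly decreasing sequences of positive integers; the part  *)
(* lambda_i (i >= 1) is [nth 0 lam i.-1], so it is 0 beyond the last part.    *)
Definition is_partition (s : seq nat) : bool := sorted geq s && (0%N \notin s).

Definition part_sub (mu lam : seq nat) : Prop :=
  forall i, (nth 0%N mu i <= nth 0%N lam i)%N.

(* A partition of m, padded with zeros to exactly m entries, is a decreasing  *)
(* m-tuple with entries at most m.                                            *)
Definition partitions_of (m : nat) : seq (seq nat) :=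
  [seq [seq i <- map val t | (0 < i)%N]
     | t : m.-tuple 'I_m.+1 <- enum {: m.-tuple 'I_m.+1}
     & sorted geq (map val t) && (sumn (map val t) == m)].

Lemma mem_partitions_of m nu :
  (nu \in partitions_of m) = is_partition nu && (sumn nu == m).
Proof.
apply/mapP/andP => [[t] | [/andP[nu_sort nu_pos] /eqP nu_sum]].
  rewrite mem_filter => /andP[/andP[t_sort /eqP t_sum] _] ->.
  rewrite /is_partition mem_filter andbT sorted_filter //; last first.
    by move=> x y z /= xy yz; apply: leq_trans yz xy.
  split=> //; apply/eqP; rewrite -{}[RHS]t_sum.
  by elim: (map val t) => //= -[|x] s IHs //=; rewrite IHs.
have nu_le i : i \in nu -> (i < m.+1)%N.
  by move=> i_nu; rewrite ltnS -nu_sum (perm_sumn (perm_to_rem i_nu)) leq_addr.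
have nu_size : (size nu <= m)%N.
  rewrite -nu_sum; elim: nu nu_pos {nu_sort nu_sum nu_le} => //= x s IHs.
  by rewrite inE negb_or => /andP[x0 /IHs]; lia.
set s := nu ++ nseq (m - size nu) 0%N.
have s_size : size (map (inord : nat -> 'I_m.+1) s) == m.
  by rewrite size_map size_cat size_nseq subnKC.
have s_val : map val (Tuple s_size) = s.
  rewrite -map_comp /= map_id_in // => i; rewrite mem_cat => /orP[/nu_le|].
    by move=> ?; rewrite /= inordK.
  by rewrite mem_nseq => /andP[_ /eqP->]; rewrite /= inordK.
exists (Tuple s_size); rewrite ?s_val.
  rewrite mem_filter s_val mem_enum andbT /s sumn_cat sumn_nseq mul0n addn0 nu_sum eqxx andbT.
  rewrite sorted_pairwise ?pairwise_cat; last first.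
    by move=> x y z /= xy yz; apply: leq_trans yz xy.
  rewrite -sorted_pairwise ?nu_sort; last first.
    by move=> x y z /= xy yz; apply: leq_trans yz xy.
  apply/andP; split; first by apply/allrelP => x y _ /nseqP[->].
  by elim: (m - _)%N => //= n ->; rewrite andbT; apply/allP => y /nseqP[->].
rewrite /s filter_cat (_ : [seq i <- nseq _ _ | _] = [::]) ?cats0.
  by apply/esym/all_filterP/allP => -[|i] //; rewrite (negPf nu_pos).
by elim: (m - _)%N.
Qed.

Lemma partitions_of_uniq m : uniq (partitions_of m).
Proof.
have geq_trans : transitive geq.
  by move=> x y z /= xy yz; apply: leq_trans yz xy.
have split0 s : sorted geq s ->
    s = [seq i <- s | (0 < i)%N] ++ nseq (size s - size [seq i <- s | (0 < i)%N]) 0%N.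
  elim: s => //= -[|x] s IHs s_sort; last first.
    by rewrite /= subSS -IHs // (path_sorted s_sort).
  suff -> : s = nseq (size s) 0%N.
    move: (size s) => n; rewrite (_ : filter _ _ = [::]) ?size_nseq ?subn0 //.
    by elim: n.
  apply/all_pred1P/allP => y /(allP (order_path_min geq_trans s_sort)) /=.
  by rewrite leqn0.
rewrite map_inj_in_uniq => [|t u]; first by apply: filter_uniq; apply: enum_uniq.
rewrite !mem_filter => /andP[/andP[t_sort _] _] /andP[/andP[u_sort _] _] tu.
apply/val_inj/(inj_map val_inj).
by rewrite (split0 _ t_sort) (split0 _ u_sort) tu !size_map !size_tuple.
Qed.

(* Matrix coordinates (row, column), rows increasing downwards and columns    *)
(* increasing to the right.  Coordinates are in Z so that diagrams can be     *)
(* rotated and shifted freely; only relative positions matter below.          *)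
Definition box : Type := (int * int)%type.
Definition diagram : Type := {fset box}.

Definition skew_diagram (lam mu : seq nat) : diagram :=
  [fset x in [seq (i.+1%:Z, j.+1%:Z)
               | i <- iota 0 (size lam),
                 j <- iota (nth 0%N mu i) (nth 0%N lam i - nth 0%N mu i)%N]].

Definition ferrers (nu : seq nat) : diagram := skew_diagram nu [::].

Definition rot180 (D : diagram) : diagram := [fset (- x.1, - x.2) | x in D].

Definition semistandard (D : diagram) (n : nat) (T : {ffun D -> 'I_n}) : bool :=
  [forall x : D, forall y : D,
    [&& ((val x).1 == (val y).1) && ((val x).2 < (val y).2) ==> (T x <= T y)%N
      & ((val x).2 == (val y).2) && ((val x).1 < (val y).1) ==> (T x < T y)%N]].

(* A symmetric function in x_1, x_2, ... is given by all its truncations      *)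
(* to finitely many variables x_1, ..., x_n.                                  *)
Definition symfun : Type := forall n : nat, {mpoly int[n]}.

Definition schur (D : diagram) : symfun := fun n =>
  \sum_(T : {ffun D -> 'I_n} | semistandard T) \prod_(x : D) 'X_(T x).

Definition schur_positive (f : symfun) : Prop :=
  exists (P : {fset seq nat}) (c : seq nat -> int),
    [/\ forall nu, nu \in P -> is_partition nu,
        forall nu, nu \in P -> 0 <= c nu
      & forall n, f n = \sum_(nu <- P) c nu *: schur (ferrers nu) n].

Definition schur_le (f g : symfun) : Prop :=
  schur_positive (fun n => g n - f n).

(* y weakly precedes x in the reverse reading order: rows from top to bottom, *)
(* each row from right to left.                                               *)
Definition reading_le (y x : box) : bool :=
  (y.1 < x.1) || ((y.1 == x.1) && (x.2 <= y.2)).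

(* Entries are 0-based: i : 'I_n stands for the tableau entry i + 1.          *)
Definition has_content (D : diagram) (nu : seq nat)
    (T : {ffun D -> 'I_(size nu)}) : bool :=
  [forall i, #|[set x : D | T x == i]| == nth 0%N nu i].

Definition lattice_filling (D : diagram) (n : nat) (T : {ffun D -> 'I_n}) : bool :=
  [forall x : D, forall i : 'I_n, forall j : 'I_n, (j == i.+1 :> nat) ==>
    (#|[set y : D | reading_le (val y) (val x) & T y == j]|
       <= #|[set y : D | reading_le (val y) (val x) & T y == i]|)%N].

(* The coefficient c_{kappa nu}^{rho}: the number of Littlewood-Richardson    *)
(* tableaux of shape rho/kappa and content nu.                                *)
Definition lr_coef (kappa nu rho : seq nat) : nat :=
  #|[set T : {ffun skew_diagram rho kappa -> 'I_(size nu)} |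
      [&& semistandard T, has_content T & lattice_filling T]]|.

Definition is_composition (a : seq nat) : bool := 0%N \notin a.

Definition delta (a : seq nat) : seq nat :=
  flatten [seq nseq (nth 0%N a i.-1) i | i <- rev (iota 1 (size a))].

Definition Delta (a : seq nat) : diagram := rot180 (ferrers (delta a)).

(* For a fat staircase the number of distinct part sizes is the largest part. *)
Definition alpha (nu : seq nat) : seq nat :=
  [seq count_mem i nu | i <- iota 1 (head 0%N nu)].

(* Decidable form of "nu = delta a for some composition a"; see               *)
(* fat_staircaseP.                                                            *)
Definition fat_staircase (nu : seq nat) : bool :=
  is_composition (alpha nu) && (nu == delta (alpha nu)).

Lemma fat_staircaseP nu :
  reflect (exists2 a, is_composition a & nu = delta a) (fat_staircase nu).
Proof.
apply: (iffP andP) => [[comp /eqP nuE]|[a comp ->]]; first by exists (alpha nu).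
suff aE : alpha (delta a) = a by rewrite aE eqxx.
have hd : head 0%N (delta a) = size a.
  case/lastP: a comp => // a x; rewrite /is_composition /delta mem_rcons inE.
  rewrite negb_or size_rcons -(addn1 (size a)) iotaD.
  by rewrite rev_cat addn1 /= nth_rcons ltnn eqxx; case: x.
rewrite /alpha hd; apply: (@eq_from_nth _ 0%N); rewrite size_map size_iota //.
move=> i lt_i; rewrite (nth_map 0%N) ?size_iota // nth_iota // add1n.
rewrite count_flatten -map_comp map_rev sumn_rev.
rewrite (eq_map (g := fun j => ((j == i.+1) * nth 0%N a j.-1)%N)); last first.
  by move=> j; rewrite /= count_nseq.
rewrite sumnE big_map (bigD1_seq i.+1) ?iota_uniq ?mem_iota //=.
by rewrite eqxx mul1n big1 ?addn0 // => j /negPf->.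
Qed.

Definition bl_order (x y : box) : bool :=
  (y.1 < x.1) || ((x.1 == y.1) && (x.2 <= y.2)).

(* Leftmost box of the bottom row; the value (0, 0) on the empty diagram is   *)
(* a dummy.                                                                   *)
Definition bottom_left (D : diagram) : box := head (0, 0) (sort bl_order D).

Lemma bottom_leftP D : D != fset0 ->
  bottom_left D \in D /\ {in D, forall x, bl_order (bottom_left D) x}.
Proof.
have bl_trans : transitive bl_order by move=> y x z; rewrite /bl_order; lia.
have bl_total : total bl_order by move=> x y; rewrite /bl_order; lia.
move=> D0; have := sort_sorted bl_total D; have memD := mem_sort bl_order D.
rewrite /bottom_left; case: (sort _ _) memD => [|x s] memD /=.
  by case/fset0Pn: D0 => y yD; have := memD y; rewrite yD.
move=> /(order_path_min bl_trans)/allP x_min.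
split=> [|y]; first by rewrite -memD mem_head.
rewrite -memD inE => /predU1P[->|/x_min //].
by rewrite /bl_order eqxx lexx orbT.
Qed.

Definition last_row_length (D : diagram) : nat :=
  #|` [fset x in D | x.1 == (bottom_left D).1] |.

Definition stack (lam mu : seq nat) (D : diagram) (k : nat) : diagram :=
  let: (r, c) := bottom_left D in
  D `|` [fset (r + x.1, c - k%:Z + x.2 - (nth 0%N mu 0)%:Z - 1)
           | x in skew_diagram lam mu].

(* Restricting the sum to partitions nu of the number of boxes of rho/kappa   *)
(* loses nothing: c_{kappa nu}^{rho} = 0 for every other partition nu.        *)
Definition sum_of_fat_staircases (rho kappa : seq nat) : Prop :=
  forall n, schur (skew_diagram rho kappa) n =
    \sum_(nu <- partitions_of #|` skew_diagram rho kappa | | fat_staircase nu)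
      schur (ferrers nu) n *+ lr_coef kappa nu rho.

(* Main.v *)
(* For every skew shape D, a Littlewood-Richardson filling of S(lambda, mu, D; k)
   is, in the reading order, a Littlewood-Richardson filling T of D, of content
   nu say, followed by a filling of lambda/mu that continues the lattice word.
   Replacing (D, T) by Delta, the rotation of nu, with its only
   Littlewood-Richardson filling of content nu (each column of height h is filled
   with 1..h) preserves the lattice condition.  It also preserves column
   strictness along the overlap: the entries i of the last row of T form a
   horizontal strip, so at most nu_1 - nu_(v+1) of them are at most v, which says
   that the t-th entry of that row is at least the t-th entry of the last row of
   Delta.  Hence the Littlewood-Richardson coefficients of S(lambda, mu, D; k) are
   bounded by those of the right-hand side, for an arbitrary D; fat staircases
   only enter because the coefficient of every other nu vanishes.

   The Littlewood-Richardson rule is proved after Stembridge: multiply s_D by the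
   alternant a_rho and cancel the fillings that are not lattice, applying a
   Bender-Knuth involution to the boxes read after the first failure. *)

Require Import Defs.
From HB Require Import structures.
From mathcomp Require Import all_boot all_order all_fingroup all_algebra.
From mathcomp Require Import finmap mpoly zify.

Set Implicit Arguments.
Unset Strict Implicit.
Unset Printing Implicit Defensive.

Import Order.TTheory GRing.Theory Num.Theory.

Local Open Scope fset_scope.
Local Open Scope ring_scope.

(** * Alternants *)

Section Alternant.

Variable n : nat.
Implicit Types (p f : {mpoly int[n]}) (e : 'I_n -> nat) (s : 'S_n).

Definition altern p := \sum_(s : 'S_n) (-1) ^+ s * msym s p.

Definition monomial e : {mpoly int[n]} := \prod_(i < n) 'X_i ^+ e i.

(** The staircase exponent (n-1, ..., 1, 0), whose alternant is the Vandermonde determinant; the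
    name is that of the Weyl vector, not of the outer partition of a skew shape. *)
Definition rho_exp (i : 'I_n) : nat := n - i.+1.

Lemma msym_var s i : msym s ('X_i : {mpoly int[n]}) = 'X_(s i).
Proof.
rewrite msymX; congr 'X_[_]; apply/mnmP => j; rewrite mnmE !mnm1E.
by rewrite -(inj_eq (@perm_inj _ s)) permKV.
Qed.

Lemma msym_monomial s e : msym s (monomial e) = \prod_(i < n) 'X_(s i) ^+ e i.
Proof.
by rewrite rmorph_prod; apply: eq_bigr => i _; rewrite rmorphXn /= msym_var.
Qed.

Lemma altern_mulr p f : f \is symmetric -> altern (p * f) = altern p * f.
Proof.
move=> /issymP f_sym; rewrite /altern mulr_suml; apply: eq_bigr => s _.
by rewrite msymM f_sym mulrA.
Qed.

Lemma altern_sum (I : finType) (P : pred I) (F : I -> {mpoly int[n]}) :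
  altern (\sum_(i | P i) F i) = \sum_(i | P i) altern (F i).
Proof.
rewrite /altern exchange_big /=; apply: eq_bigr => s _.
by rewrite raddf_sum mulr_sumr.
Qed.

Lemma altern_msym_tperm (i j : 'I_n) p :
  i != j -> altern (msym (tperm i j) p) = - altern p.
Proof.
move=> ij; rewrite /altern [in RHS](reindex_inj (mulgI (tperm i j))) -sumrN.
apply: eq_bigr => s _.
by rewrite -msymMm odd_permM odd_tperm ij signr_addb mulN1r mulNr opprK.
Qed.

Lemma symmetric_adjacent f :
  (forall i j : 'I_n, j = i.+1 :> nat -> msym (tperm i j) f = f) ->
  f \is symmetric.
Proof.
move=> f_adj.
have f_tperm (i : 'I_n) d (j : 'I_n) : j = (i + d)%N :> nat -> msym (tperm i j) f = f.
  elim: d j => [|d IHd] j jE.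
    by rewrite (_ : j = i) ?tperm1 ?msym1m //; apply/val_inj; rewrite /= jE addn0.
  have lt_d : (i + d < n)%N by have := ltn_ord j; lia.
  case: d => [|d] in IHd jE lt_d *; first by apply: f_adj; rewrite jE addn1.
  pose h := Ordinal lt_d.
  (* With h = j - 1, the transposition (i j) is the conjugate of (i h) by the adjacent transposition
     (h j). *)
  have -> : tperm i j = (tperm i h ^ tperm h j)%g.
    rewrite tpermJ tpermL tpermD //; apply/eqP => /(congr1 val) /=; lia.
  have fhj : msym (tperm h j) f = f by apply: f_adj; rewrite jE /=; lia.
  by rewrite /conjg tpermV !msymMm fhj IHd // fhj.
have f_tperm2 (i j : 'I_n) : msym (tperm i j) f = f.
  case: (leqP i j) => [ij|/ltnW ij]; first by apply: (f_tperm _ (j - i)%N); lia.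
  by rewrite tpermC; apply: (f_tperm _ (i - j)%N); lia.
apply/issymP => s; have [ts -> _] := prod_tpermP s.
elim: ts => [|t ts IHts]; first by rewrite big_nil msym1m.
by rewrite big_cons msymMm f_tperm2.
Qed.

(** The entries of [rho_exp] are distinct, so only the identity permutation contributes to the
    coefficient of the leading monomial. This allows the alternant to be cancelled in
    [schur_expansion]. *)
Lemma altern_rho_neq0 : altern (monomial rho_exp) != 0.
Proof.
pose m : 'X_{1..n} := [multinom rho_exp i | i < n].
have mE : monomial rho_exp = 'X_[m].
  by rewrite mpolyXE_id; apply: eq_bigr => i _; rewrite mnmE.
apply/eqP => /(congr1 (fun p => p@_m)); rewrite raddf0 raddf_sum /=.
rewrite (bigD1 (1 : 'S_n)%g) //= odd_perm1 mul1r msym1m mE mcoeffX eqxx.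
rewrite big1 ?addr0 // => s s1.
rewrite -signr_odd mulr_sign.
have : (msym s ('X_[m] : {mpoly int[n]}))@_m = 0.
  rewrite mcoeff_sym mcoeffX; case: eqP => // /mnmP sm.
  case/eqP: s1; apply/permP => i; rewrite perm1; apply/val_inj.
  have := sm i; rewrite !mnmE /rho_exp /=.
  by have := ltn_ord i; have := ltn_ord (s i); lia.
by case: odd; rewrite ?mcoeffN => ->; rewrite ?oppr0.
Qed.

End Alternant.

(** * Bender-Knuth involutions *)

Section Flip.

Variables (X : eqType) (leX : rel X) (s : seq X).

(** Reversal of the position in [s]. The free letters of a row read i...ij...j; exchanging i and j
    makes them decrease, and the reversal makes them increase again, with the two multiplicities
    swapped. *)
Definition flip x := nth x s (size s - (index x s).+1).

Lemma flip_in x : x \in s -> flip x \in s.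
Proof. by rewrite -index_mem => xs; apply: mem_nth; lia. Qed.

Hypothesis s_uniq : uniq s.

Lemma index_flip x : x \in s -> index (flip x) s = (size s - (index x s).+1)%N.
Proof. by rewrite -index_mem => xs; apply: index_uniq => //; lia. Qed.

Lemma flipK x : x \in s -> flip (flip x) = x.
Proof.
move=> xs; rewrite {1}/flip index_flip //; have := xs; rewrite -index_mem => xs1.
rewrite (set_nth_default x); last by lia.
by rewrite (_ : (_ - _)%N = index x s) ?nth_index //; lia.
Qed.

Lemma flip_anti x y : transitive leX -> reflexive leX -> sorted leX s ->
  x \in s -> y \in s -> ~~ leX y x -> leX (flip y) (flip x).
Proof.
move=> leX_trans leX_refl s_sort xs ys.
have idx := sorted_leq_index leX_trans leX_refl s_sort.
case: (leqP (index y s) (index x s)) => [le_yx|lt_xy _]; first by rewrite idx.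
by apply: idx; rewrite ?flip_in ?index_flip //; lia.
Qed.

End Flip.

(** The form in which skewness is used: it supplies the missing corner between two boxes. Stated
    without a pair of partitions, it applies directly to stacked and rotated diagrams. *)
Definition convex (D : diagram) : Prop := forall x y z : box,
  x \in D -> y \in D -> x.1 <= z.1 <= y.1 -> x.2 <= z.2 <= y.2 -> z \in D.

Definition row_of (D : diagram) (x : D) : int := (val x).1.
Definition col_of (D : diagram) (x : D) : int := (val x).2.

Lemma box_inj (D : diagram) (x y : D) :
  row_of x = row_of y -> col_of x = col_of y -> x = y.
Proof.
rewrite /row_of /col_of => r c; apply/val_inj.
by move: r c; case: (val x) (val y) => [a b] [a' b'] /= -> ->.
Qed.

Lemma convex_box (D : diagram) (x y : D) (r c : int) : convex D ->
  row_of x <= r <= row_of y -> col_of x <= c <= col_of y ->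
  exists2 v : D, row_of v = r & col_of v = c.
Proof.
move=> convD rr cc.
have vD : (r, c) \in D by apply: (convD (val x) (val y)); rewrite ?fsvalP.
by exists [` vD].
Qed.

Lemma semistandardP (D : diagram) (n : nat) (T : {ffun D -> 'I_n}) :
  reflect ((forall x y : D, row_of x = row_of y -> col_of x < col_of y -> (T x <= T y)%N)
           /\ (forall x y : D, col_of x = col_of y -> row_of x < row_of y -> (T x < T y)%N))
          (semistandard T).
Proof.
apply: (iffP forallP) => [sst|[sst_row sst_col] x].
  split=> x y /eqP E1 E2; have /andP[/implyP h1 /implyP h2] := forallP (sst x) y.
    by apply: h1; rewrite [_ == _]E1 E2.
  by apply: h2; rewrite [_ == _]E1 E2.
apply/forallP => y; apply/andP; split; apply/implyP => /andP[/eqP E1 E2].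
  exact: sst_row.
exact: sst_col.
Qed.

Section Semistandard.

Variables (D : diagram) (n : nat) (T : {ffun D -> 'I_n}).
Hypothesis sstT : semistandard T.

Lemma sst_row x y : row_of x = row_of y -> col_of x <= col_of y -> (T x <= T y)%N.
Proof.
move=> rxy; rewrite le_eqVlt => /predU1P[cxy|]; first by rewrite (box_inj rxy cxy).
by case/semistandardP: sstT => h _; apply: h.
Qed.

Lemma sst_col x y : col_of x = col_of y -> row_of x < row_of y -> (T x < T y)%N.
Proof. by case/semistandardP: sstT => _; apply. Qed.

Lemma sst_col_le x y : col_of x = col_of y -> row_of x <= row_of y -> (T x <= T y)%N.
Proof.
move=> cxy; rewrite le_eqVlt => /predU1P[rxy|rxy]; first by rewrite (box_inj rxy cxy).
by rewrite ltnW // sst_col.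
Qed.

Lemma sst_col_above x y : col_of x = col_of y -> (T x < T y)%N -> row_of x < row_of y.
Proof.
by move=> cxy; rewrite ltNge; case: leP => // yx; rewrite ltnNge sst_col_le.
Qed.

Lemma sst_col_inj x y : col_of x = col_of y -> T x = T y -> x = y.
Proof.
move=> cxy Txy; apply: box_inj => //.
by case: (ltgtP (row_of x) (row_of y)) => // rxy;
  have := sst_col _ rxy; rewrite cxy Txy ltnn => /(_ erefl).
Qed.

End Semistandard.

Section BenderKnuthMove.

Variables (D : diagram) (E h : pred D).

Definition col_le (x y : D) : bool := col_of x <= col_of y.

(** Here [E] is the region that may change and [h] marks the boxes carrying either letter. A marked
    box that shares its column with another one is paired and keeps its letter. *)
Definition bk_free (x : D) : bool :=
  [&& E x, h x & [forall y, (y != x) && (col_of y == col_of x) ==> ~~ h y]].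

Definition bk_row (x : D) : seq D :=
  sort col_le [seq y <- enum {: D} | bk_free y && (row_of y == row_of x)].

Definition bk_partner (x : D) : D :=
  odflt x [pick y | [&& y != x, col_of y == col_of x & h y]].

(* The Bender-Knuth involution as a permutation of the boxes carrying one of  *)
(* the two letters: composed with the exchange of the letters, it fixes the   *)
(* paired entries and swaps the two multiplicities among the free entries of  *)
(* each row.                                                                  *)
Definition bk_move (x : D) : D :=
  if E x && h x then (if bk_free x then flip (bk_row x) x else bk_partner x) else x.

Lemma col_le_trans : transitive col_le.
Proof. by move=> y x z; apply: le_trans. Qed.

Lemma col_le_refl : reflexive col_le.
Proof. by move=> x; apply: lexx. Qed.

Lemma col_le_total : total col_le.
Proof. by move=> x y; apply: le_total. Qed.

Lemma bk_row_uniq x : uniq (bk_row x).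
Proof. by rewrite sort_uniq filter_uniq ?enum_uniq. Qed.

Lemma mem_bk_row x y : (y \in bk_row x) = bk_free y && (row_of y == row_of x).
Proof. by rewrite mem_sort mem_filter mem_enum inE andbT. Qed.

Lemma bk_row_sorted x : sorted col_le (bk_row x).
Proof. exact: sort_sorted col_le_total _. Qed.

Lemma bk_row_eq x y : row_of x = row_of y -> bk_row x = bk_row y.
Proof. by rewrite /bk_row => ->. Qed.

Lemma bk_freeP x y : bk_free x -> col_of y = col_of x -> h y -> y = x.
Proof.
case/and3P=> _ _ /forallP/(_ y); case: (y =P x) => //= _ + cyx.
by rewrite cyx eqxx /= => /negPf->.
Qed.

Lemma bk_free_move x : bk_free x -> bk_free (bk_move x) /\ row_of (bk_move x) = row_of x.
Proof.
move=> x_free; case/and3P: (x_free) => Ex hx _; rewrite /bk_move Ex hx x_free /=.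
have : flip (bk_row x) x \in bk_row x by apply: flip_in; rewrite mem_bk_row x_free eqxx.
by rewrite mem_bk_row => /andP[? /eqP].
Qed.

Lemma bk_move_anti x y : bk_free x -> bk_free y -> row_of x = row_of y ->
  col_of x < col_of y -> col_of (bk_move y) <= col_of (bk_move x).
Proof.
move=> x_free y_free rxy cxy.
case/and3P: (x_free) => Ex hx _; case/and3P: (y_free) => Ey hy _.
rewrite /bk_move Ex hx x_free Ey hy y_free /= (bk_row_eq rxy).
apply: (flip_anti (leX := col_le)); rewrite ?bk_row_uniq ?bk_row_sorted //.
- exact: col_le_trans.
- exact: col_le_refl.
- by rewrite mem_bk_row x_free rxy eqxx.
- by rewrite mem_bk_row y_free eqxx.
- by rewrite /col_le -ltNge.
Qed.

Lemma bk_nonfree x : E x -> h x -> ~~ bk_free x ->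
  [/\ bk_partner x != x, col_of (bk_partner x) = col_of x & h (bk_partner x)].
Proof.
move=> Ex hx; rewrite /bk_free Ex hx /= /bk_partner => /forallPn[y].
rewrite negb_imply negbK => /andP[/andP[yx cyx] hy].
case: pickP => [z /and3P[zx /eqP czx hz] //|/(_ y)].
by rewrite yx cyx hy.
Qed.

Hypothesis boundary : forall x y, E x -> ~~ E y -> col_of x = col_of y ->
  h x -> h y -> False.
Hypothesis two_hits : forall x y z, col_of y = col_of x -> col_of z = col_of x ->
  h x -> h y -> h z -> y != x -> z != x -> y = z.

(** On free boxes, reversing a row list twice is the identity. On paired boxes, [two_hits] makes the
    partner of the partner the box itself, and [boundary] keeps both members of a pair in [E]. *)
Lemma bk_moveP x : [/\ E (bk_move x) = E x, h (bk_move x) = h x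
                     & bk_move (bk_move x) = x].
Proof.
case: (boolP (E x && h x)) => [/andP[Ex hx]|nEh]; last by rewrite /bk_move !(negPf nEh).
case: (boolP (bk_free x)) => x_free.
  have [m_free m_row] := bk_free_move x_free; case/and3P: (m_free) => Em hm _.
  split; rewrite ?Ex ?hx // {1}/bk_move Em hm m_free /= (bk_row_eq m_row).
  rewrite {1}/bk_move Ex hx x_free /= flipK ?bk_row_uniq //.
  by rewrite mem_bk_row x_free eqxx.
have [px cpx hpx] := bk_nonfree Ex hx x_free.
have mE : bk_move x = bk_partner x by rewrite /bk_move Ex hx (negPf x_free).
have Ep : E (bk_partner x).
  by apply/negPn/negP => nE; apply: (boundary Ex nE).
rewrite mE Ex Ep hx hpx; split=> //; rewrite /bk_move Ep hpx /=.
have np_free : ~~ bk_free (bk_partner x).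
  by apply/negP => p_free; move: px; rewrite -(bk_freeP p_free (esym cpx) hx) eqxx.
have [ppx cppx hppx] := bk_nonfree Ep hpx np_free.
rewrite (negPf np_free); apply: (two_hits _ _ hpx) => //.
by rewrite eq_sym.
Qed.

End BenderKnuthMove.

Lemma eq_bk_move (D : diagram) (E E' h h' : pred D) :
  E =1 E' -> h =1 h' -> bk_move E h =1 bk_move E' h'.
Proof.
move=> EE hh x.
have ff : bk_free E h =1 bk_free E' h'.
  move=> y; rewrite /bk_free EE hh; congr [&& _, _ & _].
  by apply: eq_forallb => z; rewrite hh.
rewrite /bk_move /bk_row /bk_partner EE hh ff.
have -> : [seq y <- enum {: D} | bk_free E h y && (row_of y == row_of x)]
        = [seq y <- enum {: D} | bk_free E' h' y && (row_of y == row_of x)].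
  by apply: eq_filter => y; rewrite ff.
have -> // : [pick y | [&& y != x, col_of y == col_of x & h y]]
        = [pick y | [&& y != x, col_of y == col_of x & h' y]].
by apply: eq_pick => y /=; rewrite hh.
Qed.

Section BenderKnuth.

Variables (D : diagram) (n : nat) (i j : 'I_n).
Hypothesis ij : j = i.+1 :> nat.
Implicit Types (E : pred D) (T : {ffun D -> 'I_n}).

Definition hit T (x : D) : bool := (T x == i) || (T x == j).

Definition bk E T : {ffun D -> 'I_n} :=
  [ffun x => if E x then tperm i j (T (bk_move E (hit T) x)) else T x].

(* The cut between [E] and its complement does not interfere with the letters *)
(* [i] and [j].                                                               *)
Definition bk_cut E T : Prop :=
  (forall x y : D, E x -> ~~ E y -> col_of x = col_of y -> hit T x -> hit T y -> False) /\
  (forall x y : D, E x -> ~~ E y -> row_of x = row_of y ->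
     col_of x < col_of y /\ (j <= T y)%N).

Lemma i_neq_j : i != j.
Proof. by apply/eqP => ij'; move: ij; rewrite ij'; lia. Qed.

Lemma hit_nat T x : hit T x = ((T x == i :> nat) || (T x == i.+1 :> nat)).
Proof. by rewrite /hit -!val_eqE /= -ij. Qed.

Variables (E : pred D) (T : {ffun D -> 'I_n}).
Hypotheses (convD : convex D) (sstT : semistandard T) (cutT : bk_cut E T).

Let h := hit T.
Let mv := bk_move E h.

Lemma hit_two x y z : col_of y = col_of x -> col_of z = col_of x ->
  h x -> h y -> h z -> y != x -> z != x -> y = z.
Proof.
move=> cy cz hx hy hz yx zx; apply: (sst_col_inj sstT); first by rewrite cz.
have Tyx : T y != T x by apply: contraNneq yx => /(sst_col_inj sstT)->.
have Tzx : T z != T x by apply: contraNneq zx => /(sst_col_inj sstT)->.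
by move: hx hy hz Tyx Tzx; rewrite /h /hit => /orP[]/eqP-> /orP[]/eqP->
  /orP[]/eqP->; rewrite ?eqxx //=.
Qed.

Lemma mvP x : [/\ E (mv x) = E x, h (mv x) = h x & mv (mv x) = x].
Proof. by apply: bk_moveP; [apply: cutT.1 | apply: hit_two]. Qed.

Lemma hit_bk x : hit (bk E T) x = h x.
Proof.
rewrite /hit ffunE; case: ifP => // Ex; have [_ <- _] := mvP x; rewrite -/mv /h /hit.
have tE z k : (tperm i j z == k) = (z == tperm i j k).
  by rewrite -(inj_eq (@perm_inj _ (tperm i j))) tpermK.
by rewrite !tE tpermL tpermR orbC.
Qed.

Lemma bkK : bk E (bk E T) = T.
Proof.
apply/ffunP => x; rewrite !ffunE (eq_bk_move (frefl E) hit_bk) -/mv.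
have [-> _ mvK] := mvP x.
by rewrite mvK; case: (E x); rewrite ?tpermK.
Qed.

Lemma bk_notE x : ~~ E x -> bk E T x = T x.
Proof. by move=> /negPf nEx; rewrite ffunE nEx. Qed.

Lemma bk_nonfree_id x : ~~ bk_free E h x -> bk E T x = T x.
Proof.
case: (boolP (E x)) => [Ex nfree|nEx _]; last exact: bk_notE.
rewrite ffunE Ex -/mv; case: (boolP (h x)) => hx.
  have [px cpx hpx] := bk_nonfree Ex hx nfree.
  rewrite /mv /bk_move Ex hx (negPf nfree).
  have : T (bk_partner h x) != T x by apply: contraNneq px => /(sst_col_inj sstT)->.
  move: hx hpx; rewrite /h /hit => /orP[]/eqP-> /orP[]/eqP->; rewrite ?eqxx //.
    by rewrite tpermR.
  by rewrite tpermL.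
rewrite /mv /bk_move (negPf hx) andbF.
by move: hx; rewrite /h /hit negb_or => /andP[? ?]; rewrite tpermD // eq_sym.
Qed.

(** Between two free boxes the reversal restores the order. If a paired x carries j to the left of a
    free j at y, the partner of x carries i above it; convexity gives a box in the partner's row and
    the column of y, squeezed to the letter i, so y was not free. A free i to the left of a paired i
    is excluded in the same way, from below. *)
Lemma bk_row_ok x y : row_of x = row_of y -> col_of x < col_of y ->
  (bk E T x <= bk E T y)%N.
Proof.
move=> rxy cxy; have Txy := sst_row sstT rxy (ltW cxy).
case: (boolP (bk_free E h x)) => [x_free|x_nfree]; last first.
  rewrite (bk_nonfree_id x_nfree).
  case: (boolP (bk_free E h y)) => [y_free|y_nfree]; last by rewrite bk_nonfree_id.
  case/and3P: (y_free) => Ey hy _; have := hit_bk y; rewrite -/h hy hit_nat => h1.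
  case: (ltnP i (T x)) => [iTx|]; last by lia.
  have Tx : T x = j.
    by apply: val_inj; move: hy; rewrite /h hit_nat /=; lia.
  have Ty : T y = j.
    by apply: val_inj; move: hy; rewrite Tx in Txy; rewrite /h hit_nat /=; lia.
  have Ex : E x.
    by apply/negPn/negP => nEx; have [] := cutT.2 _ _ Ey nEx (esym rxy); lia.
  have hx : h x by rewrite /h /hit Tx eqxx orbT.
  have [px cpx hpx] := bk_nonfree Ex hx x_nfree; set p := bk_partner h x in px cpx hpx.
  have Tp : T p = i.
    move: hpx; rewrite /h /hit => /orP[/eqP //|/eqP Tpj].
    by case/eqP: px; apply: (sst_col_inj sstT); rewrite ?Tpj.
  have rpx : row_of p < row_of x by apply: (sst_col_above sstT); rewrite ?Tp ?Tx ?ij.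
  have [||v rv cv] := @convex_box _ p y (row_of p) (col_of y) convD.
  - by rewrite lexx -rxy ltW.
  - by rewrite cpx lexx andbT ltW.
  have Tv : (T v < T y)%N by apply: (sst_col sstT) => //; rewrite rv -rxy.
  have Tpv : (T p <= T v)%N by apply: (sst_row sstT); rewrite ?rv ?cv ?cpx // ltW.
  have vy : v = y.
    apply: (bk_freeP y_free) => //; rewrite /h hit_nat.
    by rewrite Tp in Tpv; rewrite Ty in Tv; lia.
  by rewrite vy ltnn in Tv.
case/and3P: (x_free) => Ex hx _; have := hit_bk x; rewrite -/h hx hit_nat => h1.
case: (boolP (bk_free E h y)) => [y_free|y_nfree].
  case/and3P: (y_free) => Ey hy _; rewrite !ffunE Ex Ey -/mv.
  have := bk_move_anti x_free y_free rxy cxy; rewrite -/mv => mvxy.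
  have [_ mx] := bk_free_move x_free; have [_ my] := bk_free_move y_free.
  have [_ hmx _] := mvP x; have [_ hmy _] := mvP y; rewrite -/mv in mx my.
  have := sst_row sstT (etrans my (etrans (esym rxy) (esym mx))) mvxy.
  move: hmx hmy; rewrite hx hy /h /hit.
  by move=> /orP[]/eqP-> /orP[]/eqP->; rewrite ?tpermL ?tpermR ?ij //; lia.
rewrite (bk_nonfree_id y_nfree).
case: (ltnP i (T y)) => [|Tyi]; first by lia.
have Tx : T x = i by apply: val_inj; move: hx; rewrite /h hit_nat /=; lia.
have Ty : T y = i by apply: val_inj; rewrite Tx in Txy; rewrite /=; lia.
have Ey : E y.
  by apply/negPn/negP => nEy; have [_] := cutT.2 _ _ Ex nEy rxy; rewrite Ty ij ltnn.
have hy : h y by rewrite /h /hit Ty eqxx.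
have [py cpy hpy] := bk_nonfree Ey hy y_nfree; set p := bk_partner h y in py cpy hpy.
have Tp : T p = j.
  move: hpy; rewrite /h /hit => /orP[/eqP Tpi|/eqP //].
  by case/eqP: py; apply: (sst_col_inj sstT); rewrite ?Tpi.
have rpy : row_of y < row_of p by apply: (sst_col_above sstT); rewrite ?Tp ?Ty ?ij.
have [||v rv cv] := @convex_box _ x p (row_of p) (col_of x) convD.
- by rewrite lexx rxy ltW.
- by rewrite cpy lexx ltW.
have Tv : (T x < T v)%N by apply: (sst_col sstT) => //; rewrite rv rxy.
have Tpv : (T v <= T p)%N by apply: (sst_row sstT); rewrite ?rv ?cv ?cpy // ltW.
have vx : v = x.
  apply: (bk_freeP x_free) => //; rewrite /h hit_nat.
  by rewrite Tp in Tpv; rewrite Tx in Tv; lia.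
by rewrite vx ltnn in Tv.
Qed.

(** The column of a free box contains no other i or j, so its remaining letters are below i or above
    j and compare alike with both. *)
Lemma bk_col_ok x y : col_of x = col_of y -> row_of x < row_of y ->
  (bk E T x < bk E T y)%N.
Proof.
move=> cxy rxy; have Txy := sst_col sstT cxy rxy.
have yx : y != x by apply: contraTneq rxy => ->; rewrite ltxx.
have free_h u v : bk_free E h u -> col_of u = col_of v -> v != u -> ~~ h v.
  by move=> uf cuv; apply: contraNN => hv; rewrite (bk_freeP uf (esym cuv) hv).
case: (boolP (bk_free E h x)) => [x_free|x_nfree].
  have nhy := free_h _ _ x_free cxy yx.
  rewrite (bk_nonfree_id (x := y)); last by rewrite /bk_free (negPf nhy) andbF.
  case/and3P: (x_free) => Ex hx _; have := hit_bk x; rewrite -/h hx hit_nat.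
  by move: hx nhy; rewrite /h !hit_nat; lia.
rewrite (bk_nonfree_id x_nfree).
case: (boolP (bk_free E h y)) => [y_free|y_nfree]; last by rewrite bk_nonfree_id.
have xy : x != y by rewrite eq_sym.
have nhx := free_h _ _ y_free (esym cxy) xy.
case/and3P: (y_free) => Ey hy _; have := hit_bk y; rewrite -/h hy hit_nat.
by move: hy nhx; rewrite /h !hit_nat; lia.
Qed.

Lemma bk_semistandard : semistandard (bk E T).
Proof. by apply/semistandardP; split; [apply: bk_row_ok | apply: bk_col_ok]. Qed.

Lemma bk_prod (R : comNzRingType) (F : 'I_n -> R) :
  \prod_(x | E x) F (bk E T x) = \prod_(x | E x) F (tperm i j (T x)).
Proof.
have mv_inj : injective mv by apply: (can_inj (g := mv)) => x; case: (mvP x).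
rewrite [RHS](reindex_inj mv_inj) /=; apply: eq_big => x.
  by have [-> _ _] := mvP x.
by rewrite ffunE => ->.
Qed.

End BenderKnuth.

(** * Reading order and lattice fillings *)

Lemma sum_involution (V : nmodType) (I : finType) (P : pred I) (phi : I -> I)
    (F : I -> V) :
  (forall a, P a -> P (phi a) /\ phi (phi a) = a) ->
  \sum_(a | P a) F a = \sum_(a | P a) F (phi a).
Proof.
move=> phiP; rewrite (reindex_onto phi phi); last by move=> a /phiP[].
apply: eq_bigl => a; apply/andP/idP => [[/phiP[Pa _] /eqP aE]|/phiP[-> ->]].
  by rewrite -aE.
by rewrite eqxx.
Qed.

Section ReadingOrder.

Variable D : diagram.
Implicit Types (x y z : D) (Q : pred D).

Definition precedes y x : bool := reading_le (val y) (val x).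

Lemma precedesE y x :
  precedes y x = (row_of y < row_of x) || ((row_of y == row_of x) && (col_of x <= col_of y)).
Proof. by []. Qed.

Lemma precedes_trans y x z : precedes x y -> precedes y z -> precedes x z.
Proof. by rewrite !precedesE; lia. Qed.

Lemma precedes_refl x : precedes x x.
Proof. by rewrite precedesE; lia. Qed.

Lemma precedes_total x y : precedes x y || precedes y x.
Proof. by rewrite !precedesE; lia. Qed.

Lemma precedes_anti x y : precedes x y -> precedes y x -> x = y.
Proof. by rewrite !precedesE => h1 h2; apply: box_inj; lia. Qed.

Lemma precedes_max Q x0 : Q x0 -> exists2 x, Q x & forall y, Q y -> precedes y x.
Proof.
move=> Qx0; pose rk x := #|[set y | precedes y x]|.
case: (arg_maxnP rk Qx0) => x Qx x_max; exists x => // y Qy.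
case/orP: (precedes_total y x) => // xy; apply/negPn/negP => nyx.
have /= := x_max _ Qy; rewrite /rk leqNgt => /negP[]; apply: proper_card.
apply/properP; split; last by exists y; rewrite !inE ?precedes_refl.
by apply/subsetP => z; rewrite !inE => zx; apply: precedes_trans zx xy.
Qed.

Lemma precedes_min Q x0 : Q x0 -> exists2 x, Q x & forall y, Q y -> precedes x y.
Proof.
move=> Qx0; pose rk x := #|[set y | precedes y x]|.
case: (arg_minnP rk Qx0) => x Qx x_min; exists x => // y Qy.
case/orP: (precedes_total x y) => // yx; apply/negPn/negP => nyx.
have /= := x_min _ Qy; rewrite /rk leqNgt => /negP[]; apply: proper_card.
apply/properP; split; last by exists x; rewrite !inE ?precedes_refl.
by apply/subsetP => z; rewrite !inE => zy; apply: precedes_trans zy yx.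
Qed.

Definition initial Q : Prop := forall x y, Q x -> precedes y x -> Q y.

Definition count_in (n : nat) (T : {ffun D -> 'I_n}) Q (v : nat) : nat :=
  #|[set x | Q x & T x == v :> nat]|.

Lemma eq_count_in n (T T' : {ffun D -> 'I_n}) Q v :
  (forall x, Q x -> T x = T' x) -> count_in T Q v = count_in T' Q v.
Proof.
move=> TT'; apply: eq_card => x; rewrite !inE.
by case: (boolP (Q x)) => // /TT' ->.
Qed.

Lemma sub_count_in n (T : {ffun D -> 'I_n}) (Q Q' : pred D) v :
  (forall x, Q x -> T x = v :> nat -> Q' x) -> (count_in T Q v <= count_in T Q' v)%N.
Proof.
move=> QQ'; apply/subset_leq_card/subsetP => x; rewrite !inE.
by case/andP => Qx /eqP Tx; rewrite Tx eqxx (QQ' _ Qx Tx).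
Qed.

Lemma count_in0 n (T : {ffun D -> 'I_n}) Q v :
  (forall x, Q x -> T x <> v :> nat) -> count_in T Q v = 0%N.
Proof.
move=> QT; apply/eqP; rewrite cards_eq0; apply/eqP/setP => x; rewrite !inE.
by apply/negP => /andP[/QT Tx /eqP].
Qed.

Lemma lattice_fillingP n (T : {ffun D -> 'I_n}) :
  reflect (forall x v, (count_in T (precedes^~ x) v.+1 <= count_in T (precedes^~ x) v)%N)
          (lattice_filling T).
Proof.
have countE x (i : 'I_n) :
    #|[set y : D | reading_le (val y) (val x) & T y == i]| = count_in T (precedes^~ x) i.
  by apply: eq_card => y; rewrite !inE.
apply: (iffP forallP) => [lat x v|lat x].
  case: (ltnP v.+1 n) => [lt_v|le_v]; last first.
    rewrite count_in0 // => y _; have := ltn_ord (T y); lia.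
  have := forallP (forallP (lat x) (Ordinal (ltnW lt_v))) (Ordinal lt_v).
  by rewrite eqxx /= !countE.
apply/forallP => i; apply/forallP => j; apply/implyP => /eqP ij.
by rewrite !countE ij.
Qed.

(** Take the last box of [Q] that carries v+1: the prefix ending there contains every v+1 of [Q] and
    is itself contained in [Q]. *)
Lemma initial_lattice n (T : {ffun D -> 'I_n}) Q v : initial Q ->
  (forall x, Q x -> (count_in T (precedes^~ x) v.+1 <= count_in T (precedes^~ x) v)%N) ->
  (count_in T Q v.+1 <= count_in T Q v)%N.
Proof.
move=> Q_init lat; case: (pickP (fun x => Q x && (T x == v.+1 :> nat))) => [x0 Qx0|no].
  have [x /andP[Qx _] x_max] := precedes_max (Q := fun x => Q x && (T x == v.+1 :> nat)) Qx0.
  apply: (leq_trans (n := count_in T (precedes^~ x) v.+1)).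
    by apply: sub_count_in => y Qy Ty; apply: x_max; rewrite Qy Ty eqxx.
  apply: leq_trans (lat x Qx) _.
  by apply: sub_count_in => y yx _; apply: Q_init yx.
by rewrite count_in0 // => x Qx Tx; have := no x; rewrite Qx Tx eqxx.
Qed.

End ReadingOrder.

(** * The first failure of the lattice condition *)

Section FirstFailure.

Variables (D : diagram) (n : nat).
Implicit Types (T : {ffun D -> 'I_n}) (x y z : D) (i j : 'I_n).

Definition lattice_at T x : bool := [forall i : 'I_n,
  (count_in T ((@precedes D)^~ x) i.+1 <= count_in T ((@precedes D)^~ x) i)%N].

Lemma lattice_atP T x :
  reflect (forall v, (count_in T ((@precedes D)^~ x) v.+1
                      <= count_in T ((@precedes D)^~ x) v)%N) (lattice_at T x).
Proof.
apply: (iffP forallP) => [lat v|//]; case: (ltnP v n) => [lt_v|le_v].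
  exact: (lat (Ordinal lt_v)).
by rewrite count_in0 // => y _; have := ltn_ord (T y); lia.
Qed.

Definition first_fail T (p : D * 'I_n * 'I_n) : bool :=
  let: (x, i, j) := p in
  [&& j == i.+1 :> nat,
      (count_in T ((@precedes D)^~ x) i < count_in T ((@precedes D)^~ x) j)%N
    & [forall y, precedes y x && (y != x) ==> lattice_at T y]].

Lemma first_failP T : ~~ lattice_filling T -> exists p, first_fail T p.
Proof.
move=> nlat.
have [x0 bad0] : exists x, ~~ lattice_at T x.
  apply/existsP; apply: contraNT nlat => /existsPn lat; apply/lattice_fillingP => x.
  by apply/lattice_atP/negPn/lat.
have [x bad x_min] := precedes_min (Q := fun x => ~~ lattice_at T x) bad0.
have [i] := forallPn bad; rewrite -ltnNge => lt_i.
have [y /andP[_ /eqP Ty]] : exists y, precedes y x && (T y == i.+1 :> nat).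
  have /card_gt0P[y] := leq_ltn_trans (leq0n _) lt_i.
  by rewrite inE => ?; exists y.
exists (x, i, T y); rewrite /first_fail Ty eqxx lt_i /=.
apply/forallP => z; apply/implyP => /andP[zx nzx]; apply/negPn/negP => /x_min xz.
by case/eqP: nzx; apply: precedes_anti.
Qed.

Lemma first_fail_nlattice T p : first_fail T p -> ~~ lattice_filling T.
Proof.
case: p => [[x i] j] /and3P[/eqP ij fail _]; apply/negP => /lattice_fillingP/(_ x i).
by rewrite -ij leqNgt fail.
Qed.

Lemma eq_count_prefix T T' x v : (forall y, precedes y x -> T y = T' y) ->
  count_in T ((@precedes D)^~ x) v = count_in T' ((@precedes D)^~ x) v.
Proof. exact: eq_count_in. Qed.

Lemma eq_lattice_at T T' x : (forall y, precedes y x -> T y = T' y) ->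
  lattice_at T x = lattice_at T' x.
Proof. by move=> TT'; apply: eq_forallb => i; rewrite !(eq_count_prefix _ TT'). Qed.

Lemma first_fail_at T x i j : first_fail T (x, i, j) -> lattice_at T x = false.
Proof.
case/and3P=> /eqP ij fail _; apply/negP => /lattice_atP/(_ i).
by rewrite -ij leqNgt fail.
Qed.

(** Being a first failure at a box depends only on the letters read up to it. The box x is bad for
    both fillings, so triples at later boxes are rejected for both. Hence the same triple is picked
    before and after a change of the later letters, which makes [lr_switch] an involution. *)
Lemma eq_first_fail T T' x i j : (forall y, precedes y x -> T y = T' y) ->
  first_fail T (x, i, j) -> first_fail T =1 first_fail T'.
Proof.
move=> TT' ff [[x' i'] j'].
have T'x : lattice_at T' x = false by rewrite -(eq_lattice_at TT') (first_fail_at ff).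
case: (boolP (precedes x' x)) => x'x.
  have TTx' y : precedes y x' -> T y = T' y.
    by move=> yx'; apply: TT'; apply: precedes_trans x'x.
  rewrite /first_fail !(eq_count_prefix _ TTx'); congr [&& _, _ & _].
  apply: eq_forallb => y; case: (boolP (precedes y x')) => //= yx'; congr (_ ==> _).
  by apply: eq_lattice_at => z zy; apply: TTx'; apply: precedes_trans yx'.
have xx' : precedes x x' by have := precedes_total x x'; rewrite (negPf x'x) orbF.
have nx : x != x' by apply: contraNneq x'x => ->; apply: precedes_refl.
have bad U : lattice_at U x = false -> first_fail U (x', i', j') = false.
  move=> Ux; apply/negP => /and3P[_ _ /forallP/(_ x)].
  by rewrite xx' nx Ux.
by rewrite !bad // (first_fail_at ff).
Qed.

Section Cut.

Variables (T : {ffun D -> 'I_n}) (x : D) (i j : 'I_n).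
Hypotheses (convD : convex D) (sstT : semistandard T) (ff : first_fail T (x, i, j)).

Let before y := precedes y x && (y != x).

Lemma first_fail_succ : j = i.+1 :> nat.
Proof. by case/and3P: ff => /eqP. Qed.

Lemma before_initial : initial before.
Proof.
move=> y z /andP[yx ny] zy; rewrite /before (precedes_trans zy yx).
by apply: contraNneq ny => zx; apply/eqP/precedes_anti; rewrite // -zx.
Qed.

Lemma before_lattice y : before y -> forall v,
  (count_in T ((@precedes D)^~ y) v.+1 <= count_in T ((@precedes D)^~ y) v)%N.
Proof. by move=> yx; apply/lattice_atP; case/and3P: ff => _ _ /forallP/(_ y)/implyP->. Qed.

Lemma count_before v :
  count_in T ((@precedes D)^~ x) v = (count_in T before v + (T x == v :> nat))%N.
Proof.
rewrite /count_in (cardsD1 x) !inE precedes_refl addnC; congr (_ + _)%N.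
by apply: eq_card => y; rewrite !inE /before andbCA andbA.
Qed.

(** Strictly before x the lattice condition still holds, and one box changes a count by at most one;
    so the two counts were equal and x carries j. *)
Lemma first_fail_letter : T x = j /\ count_in T before i = count_in T before j.
Proof.
have [_ lt_ij _] := and3P ff; move: lt_ij; rewrite !count_before.
have := initial_lattice before_initial (fun y Qy => before_lattice Qy i).
rewrite -first_fail_succ => le_ij lt_ij; have ijN := first_fail_succ.
have Tx : T x = j by apply: val_inj => /=; lia.
by split=> //; move: lt_ij; rewrite Tx; lia.
Qed.

(** In the row of x, the boxes already read lie to the right of the others and carry letters at
    least [T x], which is j. A pair i over j separated by the cut would force a failure of the
    lattice condition before x. *)
Lemma first_fail_cut : bk_cut i j (fun y => ~~ precedes y x) T.
Proof.
have ij := first_fail_succ; have [Tx cnt_ij] := first_fail_letter.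
have row_cut u w : ~~ precedes u x -> ~~ ~~ precedes w x -> row_of u = row_of w ->
    col_of u < col_of w /\ (j <= T w)%N.
  rewrite negbK !precedesE => ux wx ruw; split; first by lia.
  by rewrite -Tx; apply: (sst_row sstT); lia.
split=> // u w ux wx cuw hu hw.
have rwu : row_of w <= row_of u by move: ux wx; rewrite negbK !precedesE; lia.
have {rwu} rwu : row_of w < row_of u.
  rewrite lt_neqAle rwu andbT; apply/eqP => /esym ruw.
  by have [] := row_cut _ _ ux wx ruw; rewrite cuw ltxx.
have := sst_col sstT (esym cuw) rwu; move: hu hw; rewrite !(hit_nat ij) => hu hw Twu.
have Tw : T w = i by apply: val_inj => /=; lia.
have Tu : T u = j by apply: val_inj => /=; lia.
have rw : row_of w < row_of x.
  move: wx; rewrite negbK precedesE => /orP[//|/andP[/eqP rwx cwx]].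
  by have := sst_row sstT (esym rwx) cwx; rewrite Tw Tx ij ltnn.
have between r : row_of w < r -> r < row_of u -> False.
  move=> wr ru; have [||v rv cv] := @convex_box _ w u r (col_of u) convD.
  - by rewrite !ltW.
  - by rewrite cuw !lexx.
  have : (T w < T v)%N by apply: (sst_col sstT); rewrite ?cv ?rv.
  have : (T v < T u)%N by apply: (sst_col sstT); rewrite ?cv ?rv.
  by rewrite Tw Tu; lia.
have rux : row_of u = row_of x.
  move: ux (between (row_of x) rw); rewrite precedesE; lia.
have cux : col_of u < col_of x by move: ux; rewrite precedesE; lia.
have between' z : row_of w < row_of z -> row_of z < row_of x -> False.
  by rewrite -rux; apply: between.
have above b : row_of b = row_of x -> col_of x <= col_of b -> T b = j ->
    exists v, [/\ row_of v = row_of w, col_of v = col_of b & T v = i].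
  move=> rb cb Tb; have [||v rv cv] := @convex_box _ w b (row_of w) (col_of b) convD.
  - by rewrite lexx rb ltW.
  - by move: cux cb; rewrite cuw; lia.
  exists v; split=> //; apply: val_inj => /=.
  have : (T w <= T v)%N by apply: (sst_row sstT); rewrite ?rv ?cv //; lia.
  have : (T v < T b)%N by apply: (sst_col sstT); rewrite ?rv ?cv ?rb.
  by rewrite Tw Tb; lia.
(* Otherwise w carries i directly above u carrying j, so each j of the row of *)
(* x read up to x has an i above it; going back to the letters read before    *)
(* those i, the prefix Q already fails the lattice condition.                 *)
pose Q y := (row_of y < row_of w) || ((row_of y == row_of w) && (i < T y)%N).
have Q_init : initial Q.
  move=> y z; rewrite /Q precedesE => Qy zy.
  case: (ltgtP (row_of z) (row_of y)) zy => [rzy _|//|rzy /= cyz]; first by lia.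
  by have := sst_row sstT (esym rzy) cyz; move: Qy; rewrite rzy; lia.
have le_Q : (count_in T Q j <= count_in T Q i)%N.
  rewrite ij; apply: initial_lattice => // y Qy; apply: before_lattice.
  have ryx : row_of y < row_of x by move: Qy; rewrite /Q; lia.
  by rewrite /before precedesE ryx /=; apply: contraTneq ryx => ->; rewrite ltxx.
pose B := [set b | [&& row_of b == row_of x, col_of x <= col_of b & T b == j]].
pose C := [set v | (row_of v == row_of w) && (T v == i)].
have le_BC : (#|B| <= #|C|)%N.
  pose up b := odflt b [pick v | [&& row_of v == row_of w, col_of v == col_of b & T v == i]].
  have upP b : b \in B -> [/\ row_of (up b) = row_of w, col_of (up b) = col_of b & T (up b) = i].
    rewrite inE => /and3P[/eqP rb cb /eqP Tb]; rewrite /up.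
    case: pickP => [v /and3P[/eqP ? /eqP ? /eqP ?] //|no].
    have [v [rv cv Tv]] := above b rb cb Tb.
    by have := no v; rewrite rv cv Tv !eqxx.
  rewrite -(card_in_imset (f := up)); last first.
    move=> b b' bB b'B upE; have [_ c1 _] := upP _ bB; have [_ c2 _] := upP _ b'B.
    apply: box_inj; last by rewrite -c1 -c2 upE.
    by move: bB b'B; rewrite !inE => /and3P[/eqP-> _ _] /and3P[/eqP-> _ _].
  apply/subset_leq_card/subsetP => _ /imsetP[b bB ->].
  by have [r c t] := upP _ bB; rewrite inE r t !eqxx.
have le_j : (count_in T before j + 1 <= count_in T Q j + #|B|)%N.
  have xB : x \in B by rewrite inE eqxx lexx Tx eqxx.
  rewrite (cardsD1 x B) xB addnCA addnC leq_add2l.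
  rewrite /count_in -cardsUI; apply: leq_trans (leq_addr _ _).
  apply/subset_leq_card/subsetP => y; rewrite !inE => /andP[/andP[yx nyx] /eqP Ty].
  have {}Ty : T y = j by apply: val_inj.
  rewrite nyx Ty !eqxx /= !andbT /Q Ty ij ltnSn andbT.
  by move: yx (between' y); rewrite precedesE; lia.
have le_i : (count_in T Q i + #|C| <= count_in T before i)%N.
  rewrite /count_in -cardsUI [X in (_ + X)%N](_ : _ = 0%N) ?addn0.
    apply/subset_leq_card/subsetP => y; rewrite !inE => /orP[/andP[Qy ->]|/andP[ry /eqP->]].
      have ryx : row_of y < row_of x by move: Qy; rewrite /Q; lia.
      by rewrite andbT /before precedesE ryx /=; apply: contraTneq ryx => ->; rewrite ltxx.
    have ryx : row_of y < row_of x by rewrite (eqP ry).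
    by rewrite eqxx andbT /before precedesE ryx /=; apply: contraTneq ryx => ->; rewrite ltxx.
  apply/eqP; rewrite cards_eq0; apply/eqP/setP => y; rewrite !inE.
  by apply/negP => /andP[/andP[Qy _] /andP[/eqP ry /eqP Ty]]; move: Qy; rewrite /Q ry Ty; lia.
(* With b for [before]: b_j + 1 <= Q_j + #B <= Q_i + #C <= b_i = b_j, a contradiction. *)
by move: le_Q le_BC le_j le_i cnt_ij; lia.
Qed.

End Cut.

End FirstFailure.

(** * The Littlewood-Richardson rule *)

Section Expansion.

Variables (D : diagram) (n : nat).
Hypothesis convD : convex D.
Implicit Types (T : {ffun D -> 'I_n}) (x y z : D) (i j : 'I_n).

Definition weight T : {mpoly int[n]} := \prod_(x : D) 'X_(T x).

Lemma prod_monomial T (Q : pred D) :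
  \prod_(x | Q x) 'X_(T x) = monomial (fun v : 'I_n => count_in T Q v).
Proof.
rewrite (partition_big T predT) //=; apply: eq_bigr => i _.
rewrite (eq_bigr (fun=> 'X_i)) => [|x /andP[_ /eqP-> //]].
rewrite prodr_const; congr (_ ^+ _); apply: eq_card => x.
by rewrite !inE.
Qed.

Lemma monomialM (e e' : 'I_n -> nat) :
  monomial e * monomial e' = monomial (fun v => e v + e' v)%N.
Proof. by rewrite -big_split; apply: eq_bigr => i _; rewrite exprD. Qed.

Lemma msym_tperm_monomial i j (e : 'I_n -> nat) :
  e i = e j -> msym (tperm i j) (monomial e) = monomial e.
Proof.
move=> eij; rewrite msym_monomial [RHS](reindex_inj (@perm_inj _ (tperm i j))).
apply: eq_bigr => v _; congr (_ ^+ _).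
by case: tpermP => // ->; rewrite eij.
Qed.

(** The classical Bender-Knuth argument: with the whole diagram as region, the cut conditions are
    vacuous and the involution exchanges the exponents of two adjacent variables. *)
Lemma schur_symmetric : schur D n \is symmetric.
Proof.
apply: symmetric_adjacent => i j ij; rewrite raddf_sum /=.
have cutT T : bk_cut i j predT T by split.
rewrite [RHS](sum_involution (phi := bk i j predT)) => [|T sstT]; last first.
  by split; [apply: bk_semistandard | apply: bkK].
apply: eq_bigr => T sstT.
rewrite (bk_prod sstT (cutT T) (fun k => 'X_k)).
by rewrite rmorph_prod; apply: eq_bigr => x _; rewrite /= msym_var.
Qed.

Definition lr_switch T : {ffun D -> 'I_n} :=
  if [pick p | first_fail T p] is Some (x, i, j)
  then bk i j (fun y => ~~ precedes y x) T else T.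

(** Together with the staircase exponent, the letters read up to the failure give a monomial
    symmetric in the variables i and j, while the involution exchanges these variables in the rest.
    The whole term is thus moved by a transposition, which negates its alternant. *)
Lemma lr_switchP T : semistandard T -> ~~ lattice_filling T ->
  [/\ semistandard (lr_switch T), ~~ lattice_filling (lr_switch T),
      lr_switch (lr_switch T) = T &
      altern (monomial (@rho_exp n) * weight (lr_switch T))
        = - altern (monomial (@rho_exp n) * weight T)].
Proof.
move=> sstT /first_failP[p0 ffp0].
have [[[x i] j] ff swE] : exists2 p, first_fail T p & [pick p | first_fail T p] = Some p.
  by case: pickP => [p ffp|/(_ p0)]; [exists p | rewrite ffp0].
have E : lr_switch T = bk i j (fun y => ~~ precedes y x) T by rewrite /lr_switch swE.
have ij := first_fail_succ ff; have cutT := first_fail_cut convD sstT ff.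
have preT y : precedes y x -> T y = lr_switch T y.
  by move=> yx; rewrite E bk_notE ?negbK.
have ffE := eq_first_fail preT ff.
split.
- by rewrite E; apply: bk_semistandard.
- by apply: (first_fail_nlattice (p := (x, i, j))); rewrite -ffE.
- by rewrite {1}/lr_switch -(eq_pick ffE) swE E bkK.
rewrite -(altern_msym_tperm _ (i_neq_j ij)).
congr altern; rewrite msymM /weight.
rewrite ![\prod_x 'X_(_ x)](bigID (fun y => ~~ precedes y x)) /= msymM.
rewrite E (bk_prod sstT cutT (fun k => 'X_k)).
rewrite [X in _ * (_ * X) = _](eq_bigr (fun y => 'X_(T y))) => [|y yx]; last first.
  by rewrite bk_notE.
have -> : msym (tperm i j) (\prod_(y | ~~ precedes y x) 'X_(T y))
        = \prod_(y | ~~ precedes y x) 'X_(tperm i j (T y)) :> {mpoly int[n]}.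
  by rewrite rmorph_prod; apply: eq_bigr => y _; rewrite /= msym_var.
rewrite mulrCA [RHS]mulrCA; congr (_ * _); rewrite -msymM.
have -> : \prod_(y | ~~ ~~ precedes y x) 'X_(T y)
        = \prod_(y | precedes y x) 'X_(T y) :> {mpoly int[n]}.
  by apply: eq_bigl => y; rewrite negbK.
rewrite prod_monomial monomialM msym_tperm_monomial //=.
have [Tx cE] := first_fail_letter sstT ff.
(* The prefix through x holds one more j than i, and [rho_exp] is one larger at i than at j = i+1,
   so the total exponents agree. *)
rewrite !(count_before _ x) cE Tx eqxx /rho_exp ij.
rewrite (_ : (i.+1 == i) = false); last by apply/eqP; lia.
by have := ltn_ord j; lia.
Qed.

(** The sum over the non-lattice fillings equals its own opposite by [lr_switch], hence vanishes
    over the integers. *)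
Lemma altern_schur : altern (monomial (@rho_exp n)) * schur D n =
  \sum_(T : {ffun D -> 'I_n} | semistandard T && lattice_filling T)
    altern (monomial (@rho_exp n) * weight T).
Proof.
rewrite -altern_mulr ?schur_symmetric // /schur mulr_sumr altern_sum.
rewrite (bigID (@lattice_filling D n)) /= [X in _ + X](_ : _ = 0) ?addr0 //.
set X := \sum_(_ | _) _.
have XN : X = - X.
  rewrite {1}/X (sum_involution (phi := lr_switch)) => [|T /andP[sstT nlT]].
    rewrite -sumrN; apply: eq_bigr => T /andP[sstT nlT].
    by have [_ _ _] := lr_switchP sstT nlT.
  by have [-> -> ? _] := lr_switchP sstT nlT.
apply/mpolyP => m; have := congr1 (fun p => p@_m) XN; rewrite mcoeffN mcoeff0.
by move: (X@_m) => c; lia.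
Qed.

End Expansion.

(** * Skew and Ferrers diagrams, and the alternant formula for Ferrers shapes *)

Lemma mem_skew_diagram (lam mu : seq nat) (x : box) :
  reflect (exists i j : nat, x = (i.+1%:Z, j.+1%:Z)
             /\ (nth 0%N mu i <= j < nth 0%N lam i)%N)
          (x \in skew_diagram lam mu).
Proof.
rewrite inE /=; apply: (iffP allpairsPdep) => [[i [j [_ jI ->]]]|[i [j [-> /andP[le_j lt_j]]]]].
  by exists i, j; split=> //; move: jI; rewrite mem_iota; lia.
exists i, j; rewrite !mem_iota; split=> //; last by lia.
by case: (ltnP i (size lam)) => // le_i; rewrite nth_default in lt_j.
Qed.

Lemma geq_trans : transitive geq.
Proof. by move=> x y z /= xy yz; apply: leq_trans yz xy. Qed.

Lemma partition_nth (s : seq nat) i j :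
  is_partition s -> (i <= j)%N -> (nth 0%N s j <= nth 0%N s i)%N.
Proof.
case/andP=> s_sort _ ij; case: (ltnP j (size s)) => [lt_j|le_j]; last first.
  by rewrite nth_default.
apply: (sorted_leq_nth geq_trans (leqnn : reflexive geq) 0%N s_sort) => //.
by rewrite inE (leq_ltn_trans ij).
Qed.

Lemma nth_partition_gt0 nu i : is_partition nu -> (i < size nu)%N -> (0 < nth 0%N nu i)%N.
Proof.
case/andP=> _ nu0 lt_i; rewrite lt0n.
by apply: contraNneq nu0 => <-; apply: mem_nth.
Qed.

Lemma skew_diagram_convex lam mu :
  is_partition lam -> is_partition mu -> convex (skew_diagram lam mu).
Proof.
move=> lam_part mu_part x y [r c].
move=> /mem_skew_diagram[i [j [xE ij]]] /mem_skew_diagram[i' [j' [yE ij']]].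
rewrite xE yE => /= rr cc.
case: r rr => [[|a]|a] rr; try by lia.
case: c cc => [[|b]|b] cc; try by lia.
apply/mem_skew_diagram; exists a, b; split=> //.
have := @partition_nth mu i a mu_part; have := @partition_nth lam a i' lam_part.
lia.
Qed.

Lemma mem_ferrers (nu : seq nat) (x : box) :
  reflect (exists i j : nat, x = (i.+1%:Z, j.+1%:Z) /\ (j < nth 0%N nu i)%N)
          (x \in ferrers nu).
Proof.
by apply: (iffP (mem_skew_diagram _ _ _)) => [] [i [j [-> h]]];
  exists i, j; move: h; rewrite nth_nil.
Qed.

Lemma ferrers_convex nu : is_partition nu -> convex (ferrers nu).
Proof. by move=> nu_part; apply: skew_diagram_convex. Qed.

Section Ferrers.

Variables (nu : seq nat) (n : nat).
Hypothesis nu_part : is_partition nu.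
Implicit Types (T : {ffun ferrers nu -> 'I_n}) (x y z : ferrers nu).

Lemma ferrers_coord x : exists i j : nat,
  [/\ row_of x = i.+1%:Z, col_of x = j.+1%:Z & (j < nth 0%N nu i)%N].
Proof.
have /mem_ferrers[i [j [xE lt_j]]] := fsvalP x.
by exists i, j; rewrite /row_of /col_of [val x]xE.
Qed.

Lemma ferrers_box i j : (j < nth 0%N nu i)%N ->
  exists2 x : ferrers nu, row_of x = i.+1%:Z & col_of x = j.+1%:Z.
Proof.
move=> lt_j; have xD : (i.+1%:Z, j.+1%:Z) \in ferrers nu by apply/mem_ferrers; exists i, j.
by exists [` xD].
Qed.

Lemma ferrers_ge_row T x i : semistandard T -> row_of x = i.+1%:Z -> (i <= T x)%N.
Proof.
move=> sstT; elim: i x => // i IHi x rx.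
have [i' [j [rx' cx lt_j]]] := ferrers_coord x.
have ii' : i' = i.+1 by move: rx rx'; lia.
have [|y ry cy] := @ferrers_box i j.
  by apply: leq_trans lt_j _; rewrite ii' partition_nth.
apply: leq_ltn_trans (IHi y ry) _.
by apply: (sst_col sstT); rewrite ?cx ?cy ?rx ?ry; lia.
Qed.

Lemma schur_ferrers0 : (n < size nu)%N -> schur (ferrers nu) n = 0.
Proof.
move=> lt_n; rewrite /schur big1 // => T sstT.
have [|x rx _] := @ferrers_box n 0; first exact: nth_partition_gt0.
by have := ferrers_ge_row sstT rx; rewrite leqNgt ltn_ord.
Qed.

(** By induction on the row. Its last box y is read first and carries its largest letter. Were this
    v+1 with v >= i, no v would have been read yet, since the rows above carry only letters below i;
    so the lattice condition would fail at y. *)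
Lemma lattice_ferrers T x i : semistandard T -> lattice_filling T ->
  row_of x = i.+1%:Z -> T x = i :> nat.
Proof.
move=> sstT /lattice_fillingP latT.
elim/ltn_ind: i x => i IHi x rx; apply/eqP; rewrite eqn_leq ferrers_ge_row // andbT.
have [i' [j [rx' cx lt_j]]] := ferrers_coord x.
have ii' : i' = i by move: rx rx'; lia.
rewrite {}ii' {rx'} in lt_j.
have [|y ry cy] := @ferrers_box i (nth 0%N nu i).-1; first by lia.
apply: (leq_trans (n := T y)); first by apply: (sst_row sstT); rewrite ?rx ?ry ?cx ?cy //; lia.
rewrite leqNgt; apply/negP => lt_i.
case Ty : (T y : nat) lt_i => [//|v] lt_i.
have := latT y v; rewrite [X in (_ <= X)%N -> _]count_in0 => [|z zy Tz].
  rewrite leqn0 cards_eq0 => /eqP/setP/(_ y).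
  by rewrite !inE precedes_refl Ty eqxx.
have [a [b [rz cz lt_b]]] := ferrers_coord z.
have ai : (a <= i)%N by move: zy; rewrite precedesE rz ry; lia.
move: ai; rewrite leq_eqVlt => /predU1P[ai|ai].
  have zE : z = y.
    apply: box_inj; first by rewrite rz ry ai.
    by move: zy lt_b; rewrite precedesE rz ry cz cy ai; lia.
  by move: Tz; rewrite zE Ty; lia.
by have := IHi a ai z rz; lia.
Qed.

Lemma card_ferrers_row v : #|[set x : ferrers nu | row_of x == v.+1%:Z]| = nth 0%N nu v.
Proof.
have bP (j : 'I_(nth 0%N nu v)) : (v.+1%:Z, j.+1%:Z) \in ferrers nu.
  by apply/mem_ferrers; exists v, j.
pose f j : ferrers nu := [` bP j].
have f_inj : injective f by move=> j k /(congr1 val)[]/val_inj.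
rewrite -[RHS]card_ord -(card_imset predT f_inj); apply: eq_card => x.
rewrite inE; apply/eqP/imsetP => [rx|[j _ ->] //].
have [i [j [rx' cx lt_j]]] := ferrers_coord x.
have iv : i = v by move: rx rx'; lia.
rewrite iv in lt_j rx'.
by exists (Ordinal lt_j) => //; apply: box_inj.
Qed.

Hypothesis le_n : (size nu <= n)%N.

Lemma ferrers_row_lt x : ((absz (row_of x)).-1 < n)%N.
Proof.
have [i [j [-> _ lt_j]]] := ferrers_coord x; apply: leq_trans le_n.
by case: (ltnP i (size nu)) => // le_i; rewrite nth_default in lt_j.
Qed.

(* Its uniqueness among lattice fillings makes s_nu the quotient of alternants. *)
Definition row_filling : {ffun ferrers nu -> 'I_n} := [ffun x => Ordinal (ferrers_row_lt x)].

Lemma row_fillingE x : row_of x = (row_filling x).+1%:Z.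
Proof. by rewrite ffunE /=; have [i [j [-> _ _]]] := ferrers_coord x. Qed.

Lemma row_filling_sst : semistandard row_filling.
Proof.
by apply/semistandardP; split=> x y; rewrite !row_fillingE; lia.
Qed.

Lemma count_row_filling v : count_in row_filling predT v = nth 0%N nu v.
Proof.
rewrite -card_ferrers_row; apply: eq_card => x; rewrite !inE row_fillingE /=.
by apply/eqP/eqP; lia.
Qed.

Lemma row_filling_lattice : lattice_filling row_filling.
Proof.
apply/lattice_fillingP => x v; rewrite /count_in.
(* Every v+1 has a v directly above it, which is read earlier. *)
pose up y : ferrers nu := odflt y [pick z | (row_of z == v.+1%:Z) && (col_of z == col_of y)].
have upP y : row_of y = v.+2%:Z -> row_of (up y) = v.+1%:Z /\ col_of (up y) = col_of y.
  move=> ry; rewrite /up; case: pickP => [z /andP[/eqP ? /eqP ?] //|no].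
  have [i [j [ry' cy lt_j]]] := ferrers_coord y.
  have iv : i = v.+1 by move: ry ry'; lia.
  have [|z rz cz] := @ferrers_box v j.
    by apply: leq_trans lt_j _; rewrite iv partition_nth.
  by have := no z; rewrite rz cz cy !eqxx.
set A := [set _ | _]; set B := [set _ | _].
have AP y : y \in A -> precedes y x /\ row_of y = v.+2%:Z.
  by rewrite inE => /andP[? /eqP yv]; rewrite row_fillingE yv.
rewrite -(card_in_imset (f := up)) => [|y z /AP[_ ry] /AP[_ rz] upE].
  apply/subset_leq_card/subsetP => _ /imsetP[y /AP[yx ry] ->].
  have [ru _] := upP y ry; rewrite inE; apply/andP; split.
    by move: yx; rewrite !precedesE ru ry; lia.
  by move: ru; rewrite row_fillingE => -[->].
have [_ cy] := upP y ry; have [_ cz] := upP z rz.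
by apply: box_inj; rewrite ?ry ?rz // -cy -cz upE.
Qed.

Lemma altern_schur_ferrers :
  altern (monomial (@rho_exp n)) * schur (ferrers nu) n
    = altern (monomial (fun v : 'I_n => rho_exp v + nth 0%N nu v)%N).
Proof.
rewrite altern_schur; last exact: ferrers_convex.
rewrite (big_pred1 row_filling) => [|T]; last first.
  apply/andP/eqP => [[sstT latT]|->]; last by rewrite row_filling_sst row_filling_lattice.
  apply/ffunP => x; apply/val_inj => /=.
  by rewrite (lattice_ferrers sstT latT (row_fillingE x)).
congr altern; rewrite /weight (prod_monomial _ predT) monomialM.
by apply: eq_bigr => v _; rewrite count_row_filling.
Qed.

(** The evaluation at ones counts tableaux. This positivity takes the place of linear independence
    of Schur functions in [lr_not_fat]. *)
Lemma schur_ferrers_eval : 0 < (schur (ferrers nu) n).@[fun=> 1].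
Proof.
rewrite /schur raddf_sum /= (bigD1 row_filling) ?row_filling_sst //=.
have evalE T : (\prod_(x : ferrers nu) 'X_(T x)).@[fun=> 1] = 1 :> int.
  by rewrite rmorph_prod big1 // => x _; rewrite /= mevalXU.
rewrite evalE; apply: ltr_wpDr => //; apply: sumr_ge0 => T _.
by rewrite evalE.
Qed.

End Ferrers.

Lemma nth_filter_pos (s : seq nat) i :
  sorted geq s -> nth 0%N [seq c <- s | (0 < c)%N] i = nth 0%N s i.
Proof.
elim: s i => // -[|c] s IHs i /= s_sort; last first.
  by case: i => //= i; rewrite IHs // (path_sorted s_sort).
have s0 : all (pred1 0%N) s.
  apply/allP => y /(allP (order_path_min geq_trans s_sort)) /=.
  by rewrite leqn0.
rewrite (_ : [seq c <- s | _] = [::]).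
  rewrite nth_nil; case: i => //= i; case: (ltnP i (size s)) => [lt_i|le_i].
    by have /eqP := allP s0 _ (mem_nth 0%N lt_i).
  by rewrite nth_default.
elim: s s0 {IHs s_sort} => //= c s IHs /andP[/eqP-> /IHs].
by [].
Qed.

Lemma eq_partition nu tau : is_partition nu -> is_partition tau ->
  (forall i, nth 0%N nu i = nth 0%N tau i) -> nu = tau.
Proof.
move=> nu_part tau_part E; apply: (@eq_from_nth _ 0%N) => //.
case: (ltngtP (size nu) (size tau)) => // lt.
  by have := nth_partition_gt0 tau_part lt; rewrite -E nth_default.
by have := nth_partition_gt0 nu_part lt; rewrite E nth_default.
Qed.

(** * Littlewood-Richardson coefficients of an arbitrary diagram *)

Section LittlewoodRichardson.

Variable D : diagram.

(** The alphabet size is a parameter because the expansion in n variables works with n letters,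
    whereas [lr_coef] uses [size nu] letters; [card_lr_fillings] shows that the count does not
    change. *)
Definition lr_fillings (nu : seq nat) (n : nat) : {set {ffun D -> 'I_n}} :=
  [set T | [&& semistandard T,
               [forall i : 'I_n, #|[set x : D | T x == i]| == nth 0%N nu i]
             & lattice_filling T]].

Definition lr (nu : seq nat) : nat := #|lr_fillings nu (size nu)|.

Lemma lr_fillingsP nu n (T : {ffun D -> 'I_n}) : (size nu <= n)%N ->
  reflect [/\ semistandard T, forall v, count_in T predT v = nth 0%N nu v
            & lattice_filling T] (T \in lr_fillings nu n).
Proof.
move=> le_n; rewrite inE; apply: (iffP and3P) => -[sstT contT latT]; split=> //.
  move=> v; case: (ltnP v n) => [lt_v|le_v].
    by have /eqP <- := forallP contT (Ordinal lt_v); apply: eq_card => x; rewrite !inE.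
  rewrite count_in0 ?nth_default ?(leq_trans le_n) // => x _.
  by have := ltn_ord (T x); lia.
by apply/forallP => i; rewrite -contT; apply/eqP/eq_card => x; rewrite !inE.
Qed.

Lemma eq_lr_fillings nu n m (T : {ffun D -> 'I_n}) (T' : {ffun D -> 'I_m}) :
  (size nu <= n)%N -> (size nu <= m)%N -> (forall x, T x = T' x :> nat) ->
  T \in lr_fillings nu n -> T' \in lr_fillings nu m.
Proof.
move=> le_n le_m TT' /(lr_fillingsP _ le_n)[sstT contT latT].
have cE Q v : count_in T' Q v = count_in T Q v.
  by apply: eq_card => x; rewrite !inE TT'.
apply/lr_fillingsP => //; split=> [|v|]; last 1 first.
- by apply/lattice_fillingP => x v; rewrite !cE; apply/lattice_fillingP.
- case/semistandardP: sstT => sr sc; apply/semistandardP.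
  by split=> x y; rewrite -!TT'; [apply: sr | apply: sc].
by rewrite cE.
Qed.

Lemma card_lr_fillings nu n : (size nu <= n)%N -> #|lr_fillings nu n| = lr nu.
Proof.
move=> le_n; rewrite /lr.
pose f (T : {ffun D -> 'I_(size nu)}) : {ffun D -> 'I_n} := [ffun x => widen_ord le_n (T x)].
have f_inj : injective f.
  move=> T T' /ffunP TT'; apply/ffunP => x; apply/val_inj.
  by have /(congr1 val) := TT' x; rewrite !ffunE.
rewrite -(card_imset _ f_inj); apply: eq_card => T.
apply/idP/imsetP => [TL|[T' T'L ->]]; last first.
  by apply: eq_lr_fillings T'L => // x; rewrite ffunE.
have [_ contT _] := lr_fillingsP _ le_n TL.
have Tlt x : (T x < size nu)%N.
  rewrite ltnNge; apply/negP => le_x.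
  have := contT (T x); rewrite nth_default // => /eqP; rewrite cards_eq0 => /eqP/setP/(_ x).
  by rewrite !inE eqxx.
exists [ffun x => Ordinal (Tlt x)]; last first.
  by apply/ffunP => x; apply/val_inj; rewrite !ffunE.
by apply: eq_lr_fillings TL => // x; rewrite ffunE.
Qed.

Section Shape.

Variables (n : nat) (T : {ffun D -> 'I_n}).

Definition shape_of : seq nat :=
  [seq c <- [seq count_in T predT v | v <- iota 0 n] | (0 < c)%N].

Hypothesis latT : lattice_filling T.

Lemma contents_sorted : sorted geq [seq count_in T predT v | v <- iota 0 n].
Proof.
apply/(sortedP 0%N) => i; rewrite size_map size_iota => lt_i.
rewrite !(nth_map 0%N) ?size_iota ?(ltnW lt_i) // !nth_iota ?(ltnW lt_i) //=.
by apply: initial_lattice => // x _; apply/lattice_fillingP.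
Qed.

Lemma nth_shape v : nth 0%N shape_of v = count_in T predT v.
Proof.
rewrite nth_filter_pos ?contents_sorted //.
case: (ltnP v n) => [lt_v|le_v]; first by rewrite (nth_map 0%N) ?size_iota // nth_iota.
rewrite nth_default ?size_map ?size_iota // count_in0 // => x _.
by have := ltn_ord (T x); lia.
Qed.

Lemma shape_partition : is_partition shape_of.
Proof.
by rewrite /is_partition mem_filter andbT (sorted_filter geq_trans) // contents_sorted.
Qed.

Lemma size_shape : (size shape_of <= n)%N.
Proof. by rewrite size_filter (leq_trans (count_size _ _)) // size_map size_iota. Qed.

Lemma sum_count : (\sum_(v < n) count_in T predT v)%N = #|` D|.
Proof.
rewrite cardfE -sum1_card (partition_big T predT) //=; apply: eq_bigr => v _.
by rewrite sum1_card; apply: eq_card => x; rewrite !inE.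
Qed.

Lemma sumn_shape : sumn shape_of = #|` D|.
Proof.
rewrite -sum_count -(big_mkord predT (fun v => count_in T predT v)).
rewrite -[RHS](big_map (count_in T predT) predT id) /index_iota subn0 -sumnE /shape_of.
by elim: (map _ _) => //= -[|c] s IHs //=; rewrite IHs.
Qed.

End Shape.

Lemma lr_filling_shape n (T : {ffun D -> 'I_n}) nu :
  semistandard T -> lattice_filling T -> (size nu <= n)%N -> is_partition nu ->
  (shape_of T == nu) = (T \in lr_fillings nu n).
Proof.
move=> sstT latT le_n nu_part; apply/eqP/(lr_fillingsP _ le_n) => [<-|[_ contT _]].
  by split=> // v; rewrite nth_shape.
apply: eq_partition => // [|i]; first exact: shape_partition.
by rewrite nth_shape.
Qed.

(** After multiplication by the Vandermonde alternant, each lattice filling contributes the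
    alternant of its content, which is the same alternant times a Schur function. Cancel it and
    group the fillings by content; partitions with more than n parts have Schur function zero in n
    variables. *)
Lemma schur_expansion n : convex D ->
  schur D n = \sum_(nu <- partitions_of #|` D|) schur (ferrers nu) n *+ lr nu.
Proof.
move=> convD; apply: (mulfI (altern_rho_neq0 n)).
transitivity (altern (monomial (@rho_exp n)) *
  \sum_(T : {ffun D -> 'I_n} | semistandard T && lattice_filling T)
     schur (ferrers (shape_of T)) n).
  rewrite altern_schur // mulr_sumr; apply: eq_bigr => T /andP[_ latT].
  rewrite altern_schur_ferrers ?shape_partition ?size_shape //.
  congr altern; rewrite /weight (prod_monomial _ predT) monomialM.
  by apply: eq_bigr => v _; rewrite nth_shape.
congr (_ * _).
transitivity (\sum_(T : {ffun D -> 'I_n} | semistandard T && lattice_filling T)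
  \sum_(nu <- partitions_of #|` D| | nu == shape_of T) schur (ferrers nu) n).
  apply: eq_bigr => T /andP[_ latT]; rewrite -big_filter filter_pred1_uniq ?big_seq1 //.
    exact: partitions_of_uniq.
  by rewrite mem_partitions_of shape_partition // sumn_shape eqxx.
rewrite (exchange_big_dep predT) //= [LHS]big_seq [RHS]big_seq.
apply: eq_bigr => nu; rewrite mem_partitions_of => /andP[nu_part _].
case: (leqP (size nu) n) => [le_n|lt_n]; last first.
  by rewrite schur_ferrers0 // mul0rn big1.
rewrite -(card_lr_fillings le_n) sumr_const; congr (_ *+ _); apply: eq_card => T.
rewrite unfold_in /=; apply/andP/idP => [[/andP[sstT latT]]|TL].
  by rewrite eq_sym lr_filling_shape.
have [sstT _ latT] := lr_fillingsP _ le_n TL.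
by rewrite sstT latT eq_sym lr_filling_shape.
Qed.

End LittlewoodRichardson.

Lemma lr_coefE kappa nu rho : lr_coef kappa nu rho = lr (skew_diagram rho kappa) nu.
Proof. by []. Qed.

(** * Stacked diagrams *)

(** Subtracting the hypothesis from the full expansion leaves a vanishing sum over the partitions
    that are not fat staircases. Evaluated at ones in [size nu] variables, all its terms are
    nonnegative, and the Schur function of [nu] is positive there. *)
Lemma lr_not_fat rho kappa nu : is_partition rho -> is_partition kappa ->
  sum_of_fat_staircases rho kappa ->
  nu \in partitions_of #|` skew_diagram rho kappa| -> ~~ fat_staircase nu ->
  lr (skew_diagram rho kappa) nu = 0%N.
Proof.
set D := skew_diagram rho kappa => rho_part kappa_part D_fat nuP nfat.
pose n := size nu.
have convD : convex D by apply: skew_diagram_convex.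
have fatE : schur D n = \sum_(tau <- partitions_of #|` D| | fat_staircase tau)
    schur (ferrers tau) n *+ lr D tau by exact: D_fat.
have := schur_expansion n convD; rewrite fatE [RHS](bigID fat_staircase) /=.
set F := \sum_(_ <- _ | _) _; set N := \sum_(_ <- _ | _) _ => FN.
have sum0 : N = 0 by apply: (addrI F); rewrite addr0 -FN.
have eval_ge0 tau : tau \in partitions_of #|` D| -> 0 <= (schur (ferrers tau) n).@[fun=> 1].
  rewrite mem_partitions_of => /andP[tau_part _]; case: (leqP (size tau) n) => [le_n|lt_n].
    exact/ltW/schur_ferrers_eval.
  by rewrite schur_ferrers0 // raddf0.
have := congr1 (fun p => p.@[fun=> 1]) sum0; rewrite raddf0.
rewrite /N raddf_sum -big_filter (bigD1_seq nu) ?filter_uniq ?partitions_of_uniq //=; last first.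
  by rewrite mem_filter nfat.
rewrite big_seq_cond => /eqP; rewrite paddr_eq0; last first.
- apply: sumr_ge0 => tau /andP[]; rewrite mem_filter => /andP[_ tauP] _.
  by rewrite raddfMn mulrn_wge0 // eval_ge0.
- by rewrite raddfMn mulrn_wge0 // eval_ge0.
case/andP=> + _; rewrite raddfMn mulrn_eq0 => /orP[/eqP //|].
rewrite gt_eqF //; apply: schur_ferrers_eval => //.
by move: nuP; rewrite mem_partitions_of => /andP[].
Qed.

Lemma exists_nat_shift (a b : int) : a <= b -> exists t : nat, b = a + t%:Z.
Proof. by move=> ab; exists (absz (b - a)); rewrite gez0_abs ?subr_ge0 // addrCA subrr addr0. Qed.

(* [(r, c)] is the bottom-left box and the last row has at least [m] boxes.   *)
Definition footed (D : diagram) (r c : int) (m : nat) : Prop :=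
  [/\ convex D, (forall x : box, x \in D -> x.1 <= r /\ c <= x.2)
    & forall t : nat, (t < m)%N -> (r, c + t%:Z) \in D].

Lemma footed_bottom_left D r c m : footed D r c m -> (0 < m)%N -> bottom_left D = (r, c).
Proof.
case=> _ bnd foot m0; have rcD : (r, c) \in D by have := foot 0%N m0; rewrite addr0.
have [|blD bl_min] := @bottom_leftP D; first by apply/fset0Pn; exists (r, c).
have := bl_min _ rcD; have := bnd _ blD; case: (bottom_left D) => a b; rewrite /bl_order /=.
by move=> [? ?] ?; congr (_, _); lia.
Qed.

Lemma skew_diagram_footed rho kappa (r c : int) :
  is_partition rho -> is_partition kappa -> skew_diagram rho kappa != fset0 ->
  bottom_left (skew_diagram rho kappa) = (r, c) ->
  footed (skew_diagram rho kappa) r c (last_row_length (skew_diagram rho kappa))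
  /\ (0 < last_row_length (skew_diagram rho kappa))%N.
Proof.
set D := skew_diagram _ _ => rho_part kappa_part D0 bl.
have [] := bottom_leftP D0; rewrite bl => rcD bl_min.
have /mem_skew_diagram[R [C [[rE cE] RC]]] := rcD.
(* The bottom-left box is the first box of its row in the skew shape. *)
have CE : C = nth 0%N kappa R.
  have : (R.+1%:Z, (nth 0%N kappa R).+1%:Z) \in D.
    by apply/mem_skew_diagram; exists R, (nth 0%N kappa R); split=> //; lia.
  by move/bl_min; rewrite /bl_order rE cE /=; lia.
have row_le : (last_row_length D <= nth 0%N rho R - nth 0%N kappa R)%N.
  rewrite /last_row_length bl /=.
  rewrite -(size_iota 0 (nth 0%N rho R - nth 0%N kappa R)%N).
  rewrite -(size_map (fun t : nat => (r, c + t%:Z))); apply: uniq_leq_size; first exact: fset_uniq.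
  move=> x.
  rewrite inE /= inE => /andP[xD /eqP iE].
  have /mem_skew_diagram[i [j [xE ij]]] : x \in D by [].
  have iR : i = R by move: iE; rewrite rE xE /=; lia.
  apply/mapP; exists (j - nth 0%N kappa R)%N; first by rewrite mem_iota; move: ij; rewrite iR; lia.
  by rewrite xE rE cE CE iR; move: ij; rewrite iR => ij; congr (_, _); lia.
split; last first.
  rewrite /last_row_length bl cardfs_gt0; apply/fset0Pn; exists (r, c).
  by rewrite inE /= inE eqxx andbT.
split.
- exact: skew_diagram_convex.
- move=> x xD; have := bl_min x xD; move: xD => /mem_skew_diagram[i [j [-> ij]]].
  rewrite /bl_order rE cE CE /= => h; split; first by lia.
  have iR : (i <= R)%N by lia.
  by have := partition_nth kappa_part iR; lia.
move=> t lt_t; apply/mem_skew_diagram; exists R, (C + t)%N; split; last by lia.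
by rewrite rE cE; congr (_, _); lia.
Qed.

Section Stack.

Variables (lam mu : seq nat) (k : nat).

Definition place (r c : int) (x : box) : box :=
  (r + x.1, c - k%:Z + x.2 - (nth 0%N mu 0)%:Z - 1).

Definition stack_at (D : diagram) (r c : int) : diagram :=
  D `|` [fset place r c x | x in skew_diagram lam mu].

Lemma stackE D r c : bottom_left D = (r, c) -> stack lam mu D k = stack_at D r c.
Proof. by rewrite /stack => ->. Qed.

Lemma place_inj r c : injective (place r c).
Proof. by move=> [a b] [a' b'] [/= h1 h2]; congr (_, _); lia. Qed.

Lemma skew_diagram_row_gt0 (z : box) : z \in skew_diagram lam mu -> 0 < z.1.
Proof. by case/mem_skew_diagram=> i [j [-> _]]. Qed.

Lemma mem_stack_at D r c (x : box) :
  reflect (x \in D \/ exists2 z : box, z \in skew_diagram lam mu & x = place r c z)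
          (x \in stack_at D r c).
Proof.
rewrite inE; apply: (iffP orP) => [[xD|/imfsetP[z zL ->]]|[xD|[z zL ->]]].
- by left.
- by right; exists z.
- by left.
by right; apply/imfsetP; exists z.
Qed.

Section Footed.

Variables (D : diagram) (r c : int) (m : nat).
Hypothesis footD : footed D r c m.

Lemma perm_stack_at :
  perm_eq (stack_at D r c) (enum_fset D ++
    [seq place r c z | z <- enum_fset (skew_diagram lam mu)]).
Proof.
have [_ bnd _] := footD; apply: uniq_perm => //.
  rewrite cat_uniq fset_uniq map_inj_uniq ?fset_uniq ?andbT //=; last exact: place_inj.
  apply/hasPn => _ /mapP[z /skew_diagram_row_gt0 z0 ->]; apply/negP => /bnd[] /=.
  by rewrite gerDl leNgt z0.
move=> x; rewrite mem_cat; apply/mem_stack_at/orP => [[xD|[z zL ->]]|[xD|/mapP[z zL ->]]].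
- by left.
- by right; apply/mapP; exists z.
- by left.
by right; exists z.
Qed.

Lemma card_stack_at : #|` stack_at D r c| = (#|` D| + #|` skew_diagram lam mu|)%N.
Proof. by rewrite (perm_size perm_stack_at) size_cat size_map. Qed.

(** The new case is a box z between x in the upper diagram and y in the lower one. If z is in row r
    or higher, the overlap bound puts the box of row r in its column into the last row of [D], and
    convexity of [D] applies. Otherwise the first row of [lam]/[mu] has a box in the column of z,
    and convexity of the skew shape applies. *)
Lemma stack_at_convex : is_partition lam -> is_partition mu ->
  (nth 0%N lam 0)%:Z - (nth 0%N mu 0)%:Z - k%:Z <= m%:Z -> convex (stack_at D r c).
Proof.
have [convD bnd foot] := footD => lam_part mu_part overlap.
have colL (z : box) : z \in skew_diagram lam mu -> z.2 <= (nth 0%N lam 0)%:Z.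
  case/mem_skew_diagram=> i [j [-> ij]] /=.
  by have := partition_nth lam_part (leq0n i); lia.
move=> x y z /mem_stack_at[xD|[x' x'L ->]] /mem_stack_at[yD|[y' y'L ->]];
  rewrite /place /= => rz cz; apply/mem_stack_at.
- by left; apply: (convD x y).
- have [xr xc] := bnd _ xD; have y'c := colL _ y'L.
  case: (lerP z.1 r) => [zr|rz'].
    left; have zD : (r, z.2) \in D.
      have [t tE] : exists t : nat, z.2 = c + t%:Z by apply: exists_nat_shift; lia.
      by rewrite tE; apply: foot; lia.
    by apply: (convD x (r, z.2)) => //=; lia.
  right; exists (z.1 - r, z.2 - c + k%:Z + (nth 0%N mu 0)%:Z + 1); last first.
    by rewrite /place; case: (z) => a b /=; congr (_, _); lia.
  have [b bE] : exists b : nat, z.2 - c + k%:Z + (nth 0%N mu 0)%:Z + 1 = b.+1%:Z.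
    have [|b bE] := @exists_nat_shift 1 (z.2 - c + k%:Z + (nth 0%N mu 0)%:Z + 1); first by lia.
    by exists b; lia.
  apply: (skew_diagram_convex lam_part mu_part (x := (1, b.+1%:Z)) (y := y')) => //=.
  - by apply/mem_skew_diagram; exists 0%N, b; split=> //; lia.
  - by have := skew_diagram_row_gt0 y'L; lia.
  by rewrite bE in cz *; lia.
- by have [yr _] := bnd _ yD; have := skew_diagram_row_gt0 x'L; lia.
right; exists (z.1 - r, z.2 - c + k%:Z + (nth 0%N mu 0)%:Z + 1); last first.
  by rewrite /place; case: (z) => a b /=; congr (_, _); lia.
by apply: (skew_diagram_convex lam_part mu_part x'L y'L) => /=; lia.
Qed.

End Footed.

End Stack.

(** * The last row of a Littlewood-Richardson filling *)

Section BottomRow.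

Variables (D : diagram) (r c : int) (m n : nat) (nu : seq nat) (T : {ffun D -> 'I_n}).
Hypotheses (footD : footed D r c m) (sstT : semistandard T) (latT : lattice_filling T).
Hypothesis contT : forall v, count_in T predT v = nth 0%N nu v.

(* Lattice condition for the boxes above the last row together with the boxes *)
(* of the last row that carry a letter > v.                                   *)
Lemma bottom_row_strip v :
  (count_in T (fun x => row_of x == r) v + nth 0%N nu v.+1 <= nth 0%N nu v)%N.
Proof.
have [_ bnd _] := footD.
have rowD (x : D) : row_of x <= r by have [] := bnd _ (fsvalP x).
pose Q (x : D) := (row_of x < r) || (v < T x)%N.
have Q_init : initial Q.
  move=> x y; rewrite /Q precedesE => Qx /orP[ryx|/andP[/eqP ryx cxy]].
    by have := rowD x; lia.
  have := sst_row sstT (esym ryx) cxy; move: Qx; rewrite ryx; lia.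
have lat x : Q x -> (count_in T ((@precedes D)^~ x) v.+1 <= count_in T ((@precedes D)^~ x) v)%N.
  by move=> _; apply/lattice_fillingP.
have le_Q := initial_lattice Q_init lat.
have nuE : (nth 0%N nu v.+1 <= count_in T Q v.+1)%N.
  by rewrite -contT; apply: sub_count_in => x _ Tx; rewrite /Q Tx ltnSn orbT.
have disj : (count_in T (fun x => row_of x == r) v + count_in T Q v <= nth 0%N nu v)%N.
  rewrite -contT /count_in -cardsUI [X in (_ + X)%N](_ : _ = 0%N) ?addn0.
    by apply/subset_leq_card/subsetP => x; rewrite !inE => /orP[]/andP[_ ->].
  apply/eqP; rewrite cards_eq0; apply/eqP/setP => x; rewrite !inE /Q; lia.
lia.
Qed.

(** The strip inequalities for the letters 0, ..., v telescope. *)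
Lemma bottom_row_sum v :
  (#|[set x : D | (row_of x == r) && (T x <= v)%N]| + nth 0%N nu v.+1 <= nth 0%N nu 0)%N.
Proof.
elim: v => [|v IHv].
  rewrite [X in (X + _)%N](_ : _ = count_in T (fun x => row_of x == r) 0) ?bottom_row_strip //.
  by apply: eq_card => x; rewrite !inE leqn0.
have := bottom_row_strip v.+1; move: IHv.
suff: (#|[set x : D | (row_of x == r) && (T x <= v.+1)%N]| <=
  #|[set x : D | (row_of x == r) && (T x <= v)%N]|
  + count_in T (fun x => row_of x == r) v.+1)%N by lia.
rewrite /count_in -cardsUI; apply: leq_trans (leq_addr _ _).
by apply/subset_leq_card/subsetP => x; rewrite !inE; lia.
Qed.

(** The t+1 leftmost boxes of the row carry letters at most [T x]. In terms of the conjugate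
    partition, the t-th column of the rotated diagram, counted from the left, has height at most
    [T x] + 1, so its bottom entry in the column filling is at most [T x]. *)
Lemma bottom_row_bound (x : D) (t : nat) : (t < m)%N ->
  row_of x = r -> col_of x = c + t%:Z ->
  (nth 0%N nu (T x).+1 + t.+1 <= nth 0%N nu 0)%N.
Proof.
have [_ _ foot] := footD => lt_t rx cx.
suff: (t.+1 <= #|[set y : D | (row_of y == r) && (T y <= T x)%N]|)%N.
  by have := bottom_row_sum (T x); lia.
have bP (s : 'I_t.+1) : (r, c + s%:Z) \in D by apply: foot; have := ltn_ord s; lia.
pose f s : D := [` bP s].
have f_inj : injective f.
  by move=> s s' /(congr1 val)[] h; apply/val_inj => /=; lia.
rewrite -{1}[t.+1]card_ord -(card_imset predT f_inj).
apply/subset_leq_card/subsetP => _ /imsetP[s _ ->]; rewrite inE /row_of eqxx /=.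
by apply: (sst_row sstT); rewrite ?rx ?cx // /col_of /=; have := ltn_ord s; lia.
Qed.

End BottomRow.

(** * Fillings as functions on all boxes, comparable across different diagrams *)

Section NatFillings.

Variable D : diagram.
Implicit Types (g : box -> nat) (x y : box).

Definition sst_on g : Prop :=
  (forall x y, x \in D -> y \in D -> x.1 = y.1 -> x.2 < y.2 -> (g x <= g y)%N) /\
  (forall x y, x \in D -> y \in D -> x.2 = y.2 -> x.1 < y.1 -> (g x < g y)%N).

Definition content_on g (nu : seq nat) : Prop :=
  forall v, count (fun y => g y == v) D = nth 0%N nu v.

Definition prefix_count g x v : nat := count (fun y => reading_le y x && (g y == v)) D.

Definition lattice_on g : Prop :=
  forall x v, x \in D -> (prefix_count g x v.+1 <= prefix_count g x v)%N.

Definition entry (n : nat) (F : {ffun D -> 'I_n}) (x : box) : nat :=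
  if insub x is Some s then val (F s) else 0%N.

Lemma entryE n (F : {ffun D -> 'I_n}) (s : D) : entry F (val s) = F s.
Proof. by rewrite /entry valK. Qed.

Lemma card_fset_set (P : pred box) : #|[set s : D | P (val s)]| = count P D.
Proof.
rewrite cardsE cardE size_filter -(count_map val P).
have /seq.permP -> // : perm_eq [seq val s | s <- Finite.enum (fset_sub_type D)] D.
apply: uniq_perm; rewrite ?fset_uniq ?map_inj_uniq -?enumT ?enum_uniq //; first exact: val_inj.
move=> x; apply/mapP/idP => [[s _ ->]|xD]; first exact: fsvalP.
by exists [` xD]; rewrite ?mem_enum.
Qed.

Lemma count_entry n (F : {ffun D -> 'I_n}) v :
  count_in F predT v = count (fun y => entry F y == v) D.
Proof. by rewrite -card_fset_set; apply: eq_card => s; rewrite !inE entryE. Qed.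

Lemma prefix_entry n (F : {ffun D -> 'I_n}) (s : D) v :
  count_in F ((@precedes D)^~ s) v = prefix_count (entry F) (val s) v.
Proof. by rewrite /prefix_count -card_fset_set; apply: eq_card => u; rewrite !inE entryE. Qed.

Lemma semistandard_entry n (F : {ffun D -> 'I_n}) : semistandard F <-> sst_on (entry F).
Proof.
split=> [/semistandardP[sr sc]|[sr sc]].
  split=> x y xD yD h1 h2; have := entryE F [` xD]; have := entryE F [` yD] => /= -> ->.
    exact: (sr [` xD] [` yD]).
  exact: (sc [` xD] [` yD]).
apply/semistandardP; split=> x y h1 h2; rewrite -!entryE.
  by apply: sr => //; apply: fsvalP.
by apply: sc => //; apply: fsvalP.
Qed.

Lemma lattice_entry n (F : {ffun D -> 'I_n}) : lattice_filling F <-> lattice_on (entry F).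
Proof.
split=> [/lattice_fillingP lat x v xD|lat].
  by have := lat [` xD] v; rewrite !prefix_entry.
by apply/lattice_fillingP => s v; rewrite !prefix_entry; apply/lat/fsvalP.
Qed.

Lemma lr_fillings_entry n nu (F : {ffun D -> 'I_n}) : (size nu <= n)%N ->
  F \in lr_fillings D nu n <->
    [/\ sst_on (entry F), content_on (entry F) nu & lattice_on (entry F)].
Proof.
move=> le_n; split=> [/(lr_fillingsP _ le_n)[sst cont lat]|[sst cont lat]].
  split; [exact/semistandard_entry | | exact/lattice_entry].
  by move=> v; rewrite -count_entry.
apply/lr_fillingsP => //; split; [exact/semistandard_entry | | exact/lattice_entry].
by move=> v; rewrite count_entry.
Qed.

Lemma eq_sst_on g g' : {in D, g =1 g'} -> sst_on g -> sst_on g'.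
Proof. by move=> gg' [sr sc]; split=> x y xD yD; rewrite -!gg' //; [apply: sr | apply: sc]. Qed.

Lemma eq_content_on g g' nu : {in D, g =1 g'} -> content_on g nu -> content_on g' nu.
Proof.
by move=> gg' cont v; rewrite -cont; apply: eq_in_count => x xD; rewrite gg'.
Qed.

Lemma eq_lattice_on g g' : {in D, g =1 g'} -> lattice_on g -> lattice_on g'.
Proof.
move=> gg' lat x v xD.
have E u : prefix_count g' x u = prefix_count g x u.
  by apply: eq_in_count => y yD; rewrite gg'.
by rewrite !E; apply: lat.
Qed.

Lemma entry_surj n g : (forall x, x \in D -> (g x < n)%N) ->
  exists F : {ffun D -> 'I_n}, {in D, entry F =1 g}.
Proof.
move=> g_lt; exists [ffun s : D => Ordinal (g_lt _ (fsvalP s))] => x xD.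
by have := entryE [ffun s : D => Ordinal (g_lt _ (fsvalP s))] [` xD]; rewrite ffunE.
Qed.

Lemma lr_fillings_surj n nu g : (size nu <= n)%N ->
  sst_on g -> content_on g nu -> lattice_on g ->
  exists2 F : {ffun D -> 'I_n}, F \in lr_fillings D nu n & {in D, entry F =1 g}.
Proof.
move=> le_n sst cont lat.
have [x xD|F FE] := @entry_surj n g.
  apply: leq_trans le_n; rewrite ltnNge; apply/negP => le_g.
  have := cont (g x); rewrite nth_default // => /eqP; rewrite -leqn0 leqNgt -has_count.
  by case/hasP; exists x.
exists F => //; apply/lr_fillings_entry => //.
have gF : {in D, g =1 entry F} by move=> x xD; rewrite FE.
split; [exact: eq_sst_on gF sst | exact: eq_content_on gF cont | exact: eq_lattice_on gF lat].
Qed.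

End NatFillings.

(** * The column filling of a rotated Ferrers diagram *)

Definition conj_part (nu : seq nat) (j : nat) : nat := count (fun p => j < p)%N nu.

Lemma conj_partE nu i j : is_partition nu -> (i < conj_part nu j)%N = (j < nth 0%N nu i)%N.
Proof.
case/andP=> + _; elim: nu i => [|p nu IHnu] i nu_sort; first by rewrite nth_nil.
rewrite /conj_part /=; case: (ltnP j p) => jp.
  by case: i => [|i]; rewrite ?add1n ?jp //= ltnS; apply: IHnu (path_sorted nu_sort).
have nu_le : all (geq p) nu by apply: order_path_min nu_sort; apply: geq_trans.
have -> : count (fun q => j < q)%N nu = 0%N.
  apply/eqP; rewrite -leqn0 leqNgt -has_count; apply/hasPn => q /(allP nu_le) /= qp.
  by rewrite -leqNgt (leq_trans qp).
rewrite addn0; apply/esym/negbTE; rewrite -leqNgt; case: i => [|i] //=.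
case: (ltnP i (size nu)) => [lt_i|le_i]; last by rewrite nth_default.
by apply: leq_trans jp; apply: (allP nu_le); apply: mem_nth.
Qed.

Section RotatedFerrers.

Variable nu : seq nat.
Hypothesis nu_part : is_partition nu.

Let G := rot180 (ferrers nu).

Lemma mem_rot_ferrers (x : box) :
  reflect (exists i j : nat, x = (- i.+1%:Z, - j.+1%:Z) /\ (j < nth 0%N nu i)%N) (x \in G).
Proof.
rewrite /G /rot180; apply: (iffP (imfsetP _ _ _ _)) =>
  [[y /mem_ferrers[i [j [yE lt_j]]] ->]|[i [j [-> lt_j]]]].
  by exists i, j; rewrite yE.
by exists (i.+1%:Z, j.+1%:Z) => //=; apply/mem_ferrers; exists i, j.
Qed.

Lemma rot_ferrers_footed : footed G (-1) (- (nth 0%N nu 0)%:Z) (nth 0%N nu 0).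
Proof.
split=> [x y z /mem_rot_ferrers[i [j [xE ij]]] /mem_rot_ferrers[i' [j' [yE ij']]] rz cz||].
- have convF := ferrers_convex nu_part.
  have xF : (i.+1%:Z, j.+1%:Z) \in ferrers nu by apply/mem_ferrers; exists i, j.
  have yF : (i'.+1%:Z, j'.+1%:Z) \in ferrers nu by apply/mem_ferrers; exists i', j'.
  move: rz cz; rewrite xE yE /= => rz cz.
  have zF : (- z.1, - z.2) \in ferrers nu by apply: (convF _ _ _ yF xF) => /=; lia.
  apply/imfsetP; exists (- z.1, - z.2) => //=.
  by rewrite !opprK; case: (z).
- move=> x /mem_rot_ferrers[i [j [-> ij]]] /=.
  by have := partition_nth nu_part (leq0n i); lia.
move=> t lt_t; apply/mem_rot_ferrers; exists 0%N, (nth 0%N nu 0 - t.+1)%N.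
by split; [congr (_, _) | ]; lia.
Qed.

(* Boxes are (- i, - j) with i, j >= 1, and column - j has conj_part nu j.-1 boxes. *)
Definition column_filling (x : box) : nat := (conj_part nu (absz x.2).-1 - absz x.1)%N.

Lemma column_fillingE (i j : nat) :
  column_filling (- i.+1%:Z, - j.+1%:Z) = (conj_part nu j - i.+1)%N.
Proof. by []. Qed.

Lemma conj_part_anti j j' : (j <= j')%N -> (conj_part nu j' <= conj_part nu j)%N.
Proof. by move=> jj'; apply: sub_count => p; apply: leq_trans. Qed.

Lemma column_filling_sst : sst_on G column_filling.
Proof.
split=> x y /mem_rot_ferrers[i [j [-> ij]]] /mem_rot_ferrers[i' [j' [-> ij']]] /= h1 h2;
  rewrite !column_fillingE.
  have -> : i' = i by lia.
  by apply: leq_sub2r; apply: conj_part_anti; lia.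
have jj' : j' = j by lia.
move: ij ij'; rewrite jj' -!conj_partE //; lia.
Qed.

(** The letter v occurs once in each column of height greater than v, and these are the first nu_v
    columns of the unrotated diagram. *)
Lemma column_filling_content : content_on G column_filling nu.
Proof.
move=> v; rewrite -size_filter -(size_iota 0 (nth 0%N nu v)).
rewrite -(size_map (fun j : nat => (- (conj_part nu j - v)%:Z, - j.+1%:Z) : box)).
apply: perm_size; apply: uniq_perm.
- by rewrite filter_uniq ?fset_uniq.
- by rewrite map_inj_uniq ?iota_uniq // => j j' [] _; lia.
move=> x; rewrite mem_filter; apply/andP/mapP => [[/eqP xv xG]|[j]].
  have /mem_rot_ferrers[i [j [xE ij]]] : x \in G by [].
  move: xv ij; rewrite xE column_fillingE -conj_partE // => xv ij.
  exists j; first by rewrite mem_iota add0n -conj_partE //; lia.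
  by congr (_, _); lia.
rewrite mem_iota add0n /= -conj_partE // => vj ->.
have -> : (conj_part nu j - v)%:Z = (conj_part nu j - v).-1.+1%:Z by lia.
split; first by rewrite column_fillingE; apply/eqP; lia.
apply/mem_rot_ferrers; exists (conj_part nu j - v).-1, j; split=> //.
by rewrite -conj_partE //; lia.
Qed.

(** The box directly above a v+1 carries v and is read earlier, so moving up one row injects the
    v+1's of a prefix into its v's. *)
Lemma column_filling_lattice : lattice_on G column_filling.
Proof.
move=> x v _; rewrite /prefix_count -!size_filter.
pose up (y : box) : box := (y.1 - 1, y.2).
have up_inj : injective up by move=> [a b] [a' b'] [] h1 ->; congr (_, _); lia.
rewrite -(size_map up); apply: uniq_leq_size.
  by rewrite map_inj_uniq ?filter_uniq ?fset_uniq.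
move=> z /mapP[y]; rewrite !mem_filter => /andP[/andP[yx /eqP yv] yG] {z}->.
have /mem_rot_ferrers[i [j [yE ij]]] : y \in G by [].
move: yv yx ij; rewrite yE column_fillingE -conj_partE // /up /= => yv yx ij.
have -> : - i.+1%:Z - 1 = - i.+2%:Z by lia.
rewrite column_fillingE; apply/andP; split.
  by apply/andP; split; [move: yx; rewrite /reading_le /=; lia | apply/eqP; lia].
by apply/mem_rot_ferrers; exists i.+1, j; split=> //; rewrite -conj_partE //; lia.
Qed.

End RotatedFerrers.

(** * Exchanging the upper diagram *)

Section Exchange.

Variables (lam mu : seq nat) (k : nat).
Let L := skew_diagram lam mu.

Lemma count_stack_at D r c m (P : pred box) : footed D r c m ->
  count P (stack_at lam mu k D r c) = (count P D + count (P \o place mu k r c) L)%N.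
Proof.
by move=> footD; rewrite (seq.permP (perm_stack_at lam mu k footD)) count_cat count_map.
Qed.

Variables (D : diagram) (r c : int) (m : nat).
Hypothesis footD : footed D r c m.

Let S := stack_at lam mu k D r c.

Lemma stack_at_sub x : x \in D -> x \in S.
Proof. by move=> xD; apply/mem_stack_at; left. Qed.

Lemma stack_at_place z : z \in L -> place mu k r c z \in S.
Proof. by move=> zL; apply/mem_stack_at; right; exists z. Qed.

Lemma sst_on_top g : sst_on S g -> sst_on D g.
Proof.
by case=> sr sc; split=> x y /stack_at_sub xS /stack_at_sub yS; [apply: sr | apply: sc].
Qed.

Lemma lattice_on_top g : lattice_on S g -> lattice_on D g.
Proof.
move=> lat x v xD; have [_ bnd _] := footD; have [xr _] := bnd _ xD.
have E u : prefix_count S g x u = prefix_count D g x u.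
  rewrite /prefix_count (count_stack_at _ footD) [X in (_ + X)%N](_ : _ = 0%N) ?addn0 //.
  apply/eqP; rewrite -leqn0 leqNgt -has_count; apply/hasPn => z zL /=.
  have := skew_diagram_row_gt0 zL; rewrite /reading_le /place /=.
  by move=> z0; rewrite negb_and negb_or negb_and; lia.
by rewrite -!E; apply/lat/stack_at_sub.
Qed.

Variable nu : seq nat.
Hypothesis nu_part : is_partition nu.

Let G := rot180 (ferrers nu).
Let r' : int := -1.
Let c' : int := - (nth 0%N nu 0)%:Z.
Let S' := stack_at lam mu k G r' c'.

Let footG : footed G r' c' (nth 0%N nu 0) := rot_ferrers_footed nu_part.

(** Both upper diagrams are read entirely before the lower one and have content [nu], so every
    prefix ending in the lower part has the same counts as before. Only column strictness across the
    overlap is at stake, and [bound] settles it. *)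
Lemma stack_exchange g tau : is_partition lam ->
  (nth 0%N lam 0)%:Z - (nth 0%N mu 0)%:Z - k%:Z <= m%:Z ->
  sst_on S g -> content_on S g tau -> lattice_on S g -> content_on D g nu ->
  (forall t, (t < m)%N ->
     (nth 0%N nu (g (r, (c + t%:Z)%R)).+1 + t.+1 <= nth 0%N nu 0)%N) ->
  exists g', [/\ sst_on S' g', content_on S' g' tau, lattice_on S' g'
    & forall z, z \in L -> g' (place mu k r' c' z) = g (place mu k r c z)].
Proof.
move=> lam_part overlap [sr sc] contS latS contD bound.
(* The rotated diagram ends in row -1; below it, the translation by (r + 1, c - c') carries one
   placement of the lower diagram onto the other. *)
pose g' (x : box) : nat :=
  if x.1 <= -1 then column_filling nu x else g (x.1 + (r + 1), x.2 + (c - c')).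
have g'G x : x \in G -> g' x = column_filling nu x.
  by case: footG => _ bnd _ /bnd[xr _]; rewrite /g' xr.
have g'L z : z \in L -> g' (place mu k r' c' z) = g (place mu k r c z).
  move=> zL; have z0 := skew_diagram_row_gt0 zL.
  rewrite /g' /place /= ifF; last by rewrite /r'; lia.
  by congr g; congr (_, _); rewrite /r'; lia.
have le_place w z : reading_le (place mu k r' c' w) (place mu k r' c' z)
    = reading_le (place mu k r c w) (place mu k r c z).
  by rewrite /reading_le /place /=; lia.
have countG v : count (fun y => g' y == v) G = nth 0%N nu v.
  rewrite -(column_filling_content nu_part v); apply: eq_in_count => y yG.
  by rewrite g'G.
have countL (P : pred box) v : count ((fun y => P y && (g' y == v)) \o place mu k r' c') L
    = count (fun z => P (place mu k r' c' z) && (g (place mu k r c z) == v)) L.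
  by apply: eq_in_count => z zL /=; rewrite g'L.
exists g'; split=> //.
- have [gsr gsc] := column_filling_sst nu_part.
  split=> x y /mem_stack_at[xG|[z zL ->]] /mem_stack_at[yG|[w wL ->]] /= h1 h2.
  + by rewrite !g'G //; apply: gsr.
  + have [_ bnd _] := footG; have [] := bnd _ xG; have := skew_diagram_row_gt0 wL; lia.
  + have [_ bnd _] := footG; have [] := bnd _ yG; have := skew_diagram_row_gt0 zL; lia.
  + rewrite !g'L //; apply: sr; rewrite ?stack_at_place // /place /=; lia.
  + by rewrite !g'G //; apply: gsc.
  + have [_ bnd foot] := footG; have [xr xc] := bnd _ xG.
    have /mem_skew_diagram[a [b [wE ab]]] := wL.
    have lam0 := partition_nth lam_part (leq0n a).
    move: h1; rewrite wE /= => h1.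
    (* The box w lies t columns to the right of the left end of the last row; the overlap bound
       gives t < m, so the last row of [D] has a box in the corresponding column above w. *)
    have [t tE] : exists t : nat, b = (nth 0%N mu 0 + k + t)%N.
      by exists (b - (nth 0%N mu 0 + k))%N; rewrite /c' in h1 xc; lia.
    have lt_t : (t < m)%N by lia.
    have bnd_t := bound t lt_t; have [_ _ footD3] := footD.
    have rcD := footD3 t lt_t.
    have lt_g : (g (r, (c + t%:Z)%R) < g (place mu k r c w))%N.
      apply: sc; [exact: stack_at_sub | exact: stack_at_place | |];
        rewrite wE /place /=; [rewrite tE|]; clear -L; lia.
    rewrite g'G // -wE g'L //; apply: leq_ltn_trans lt_g.
    have lt_t0 : (t < nth 0%N nu 0)%N by lia.
    have botG := foot t lt_t0.
    apply: (leq_trans (n := column_filling nu (r', c' + t%:Z))).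
      move: xr; rewrite le_eqVlt => /predU1P[xr|xr]; last first.
        by apply/ltnW/gsc => //=; lia.
      rewrite (_ : x = (r', c' + t%:Z)) //; move: xr h1.
      by case: (x) => ? ? /=; rewrite /r' => -> ?; congr (_, _); lia.
    (* Undoing the rotation, the t-th bottom box lies in column nu_0 - t - 1 (0-based). Its entry is
       the height of that column minus 1, and [bound] says that the height is at most the letter of
       [D] plus 1. *)
    have -> : (r', c' + t%:Z) = (- 1%N%:Z, - (nth 0%N nu 0 - t.+1).+1%:Z) :> box.
      by rewrite /r' /c'; congr (_, _); lia.
    rewrite column_fillingE leqNgt ltn_subRL add1n.
    by rewrite conj_partE //; lia.
  + have [_ bnd _] := footG; have [] := bnd _ yG; have := skew_diagram_row_gt0 zL; lia.
  + rewrite !g'L //; apply: sc; rewrite ?stack_at_place // /place /=; lia.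
- move=> v; rewrite -contS (count_stack_at _ footG) (count_stack_at _ footD) countG contD.
  by congr (_ + _)%N; apply: eq_in_count => z zL /=; rewrite g'L.
move=> x v /mem_stack_at[xG|[z zL ->]].
  have [_ bnd _] := footG; have [xr _] := bnd _ xG.
  have E u : prefix_count S' g' x u = prefix_count G (column_filling nu) x u.
    rewrite /prefix_count (count_stack_at _ footG) [X in (_ + X)%N](_ : _ = 0%N) ?addn0.
      by apply: eq_in_count => y yG; rewrite g'G.
    apply/eqP; rewrite -leqn0 leqNgt -has_count; apply/hasPn => z zL /=.
    have := skew_diagram_row_gt0 zL; rewrite /reading_le /place /=.
    by move=> z0; rewrite negb_and negb_or negb_and; lia.
  by rewrite !E; apply: column_filling_lattice.
have E u : prefix_count S' g' (place mu k r' c' z) u = prefix_count S g (place mu k r c z) u.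
  have z0 := skew_diagram_row_gt0 zL.
  rewrite /prefix_count (count_stack_at _ footG) (count_stack_at _ footD).
  congr (_ + _)%N.
    transitivity (nth 0%N nu u).
      rewrite -countG; apply: eq_in_count => y yG.
      have [_ bnd _] := footG; have [yr _] := bnd _ yG.
      by rewrite (_ : reading_le _ _ = true) // /reading_le /place /=; lia.
    rewrite -contD; apply: eq_in_count => y yD.
    have [_ bnd _] := footD; have [yr _] := bnd _ yD.
    by rewrite (_ : reading_le _ _ = true) // /reading_le /place /=; lia.
  by rewrite countL; apply: eq_count => w /=; rewrite le_place.
by rewrite !E; apply/latS/stack_at_place.
Qed.

End Exchange.

Lemma leq_card_rel (I J : finType) (A : {set I}) (B : {set J}) (R : I -> J -> bool) :
  (forall a, a \in A -> exists2 b, b \in B & R a b) ->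
  (forall a a' b, a \in A -> a' \in A -> R a b -> R a' b -> a = a') ->
  (#|A| <= #|B|)%N.
Proof.
move=> R_ex R_inj; pose f a := [pick b in B | R a b].
have fP a : a \in A -> exists b, [/\ f a = Some b, b \in B & R a b].
  move=> aA; rewrite /f; case: pickP => [b /andP[bB Rab]|no]; first by exists b.
  by have [b bB Rab] := R_ex a aA; have := no b; rewrite bB Rab.
rewrite -(card_in_imset (f := f)) => [|a a' aA a'A ff]; last first.
  have [b [fa _ Rab]] := fP a aA; have [b' [fa' _ Rab']] := fP a' a'A.
  by move: ff Rab'; rewrite fa fa' => -[<-]; apply: R_inj.
rewrite -(card_imset (mem B) (@Some_inj _)); apply/subset_leq_card/subsetP => _ /imsetP[a aA ->].
by have [b [-> bB _]] := fP a aA; apply: imset_f.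
Qed.

(** Classify the fillings of the stack by the content [nu] of their restriction to [D], and send
    each to that restriction paired with the exchanged filling. The map is injective: the first
    component determines the upper part, the second the lower part. *)
Lemma lr_stack_le lam mu k D r c m tau :
  is_partition lam -> is_partition mu -> footed D r c m ->
  (nth 0%N lam 0)%:Z - (nth 0%N mu 0)%:Z - k%:Z <= m%:Z ->
  (lr (stack_at lam mu k D r c) tau <=
   \sum_(nu <- partitions_of #|` D|)
      lr D nu * lr (stack_at lam mu k (rot180 (ferrers nu)) (-1) (- (nth 0%N nu 0)%:Z)) tau)%N.
Proof.
move=> lam_part mu_part footD overlap; set S := stack_at lam mu k D r c.
set n := size tau; have DS : D `<=` S by apply/fsubsetP => x; apply: stack_at_sub.
pose rs (F : {ffun S -> 'I_n}) : {ffun D -> 'I_n} := [ffun x => F (fincl DS x)].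
have rsE F : {in D, entry F =1 entry (rs F)}.
  move=> x xD; have := entryE (rs F) [` xD]; rewrite ffunE => /= ->.
  exact: (entryE F (fincl DS [` xD])).
pose A := lr_fillings S tau n.
have AP F : F \in A -> semistandard (rs F) /\ lattice_filling (rs F).
  move=> /(lr_fillings_entry F (leqnn _))[sst _ lat]; split.
    by apply/semistandard_entry/(eq_sst_on (rsE F))/(sst_on_top sst).
  by apply/lattice_entry/(eq_lattice_on (rsE F))/(lattice_on_top footD lat).
have -> : lr S tau = (\sum_(nu <- partitions_of #|` D|) #|[set F in A | shape_of (rs F) == nu]|)%N.
  rewrite -[lr S tau]/(#|A|) -sum1_card.
  transitivity (\sum_(F in A) \sum_(nu <- partitions_of #|` D| | nu == shape_of (rs F)) 1)%N.
    apply: eq_bigr => F /AP[_ latF]; rewrite -big_filter filter_pred1_uniq ?big_seq1 //.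
      exact: partitions_of_uniq.
    by rewrite mem_partitions_of shape_partition // sumn_shape eqxx.
  rewrite (exchange_big_dep predT) //=; apply: eq_bigr => nu _.
  by rewrite sum1_card; apply: eq_card => F; rewrite [RHS]in_set eq_sym.
rewrite [X in (X <= _)%N]big_seq [X in (_ <= X)%N]big_seq; apply: leq_sum => nu.
rewrite mem_partitions_of => /andP[nu_part _].
set B := [set F in A | _].
(* A nonempty class guarantees that [nu] has at most n parts, so that its fillings can be counted
   with n letters. *)
case: (set_0Vmem B) => [->|[F0]]; first by rewrite cards0.
rewrite inE => /andP[_ /eqP F0nu].
have le_n : (size nu <= n)%N by rewrite -F0nu size_shape.
rewrite -(card_lr_fillings _ le_n) -[lr _ tau]/(#|lr_fillings _ tau n|) -cardsX.
pose R (F : {ffun S -> 'I_n}) (p : {ffun D -> 'I_n} *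
    {ffun stack_at lam mu k (rot180 (ferrers nu)) (-1) (- (nth 0%N nu 0)%:Z) -> 'I_n}) :=
  all (fun x => entry p.1 x == entry F x) D &&
  all (fun z => entry p.2 (place mu k (-1) (- (nth 0%N nu 0)%:Z) z)
                == entry F (place mu k r c z)) (skew_diagram lam mu).
apply: (leq_card_rel (R := R)) => [F|F F' [T T'] _ _].
  rewrite inE => /andP[FA]; have [sstT latT] := AP F FA.
  have /(lr_fillings_entry F (leqnn _))[sst cont lat] := FA.
  rewrite (lr_filling_shape sstT latT le_n nu_part) => rsF.
  have [_ contT _] := lr_fillingsP _ le_n rsF.
  have /(lr_fillings_entry (rs F) le_n)[_ contE _] := rsF.
  have contD : content_on D (entry F) nu.
    by apply: eq_content_on contE => x xD; rewrite rsE.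
  have bound t : (t < m)%N ->
      (nth 0%N nu (entry F (r, (c + t%:Z)%R)).+1 + t.+1 <= nth 0%N nu 0)%N.
    move=> lt_t; have [_ _ foot] := footD; have xD := foot t lt_t.
    rewrite (rsE F _ xD) -[(r, _)]/(val [` xD]) entryE.
    exact: (bottom_row_bound footD sstT latT contT lt_t).
  have [g' [sst' cont' lat' g'E]] :=
    stack_exchange footD nu_part lam_part overlap sst cont lat contD bound.
  have [F' F'L F'E] := lr_fillings_surj (leqnn _) sst' cont' lat'.
  exists (rs F, F'); first by rewrite in_setX rsF.
  apply/andP; split; first by apply/allP => x xD /=; rewrite rsE.
  by apply/allP => z zL /=; rewrite F'E ?g'E ?stack_at_place.
case/andP=> /allP FD /allP FL /andP[/allP F'D /allP F'L].
apply/ffunP => s; apply/val_inj; rewrite /= -!entryE.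
have /mem_stack_at[xD|[z zL zE]] := fsvalP s.
  by rewrite -(eqP (FD _ xD)) (eqP (F'D _ xD)).
by rewrite [val s]zE -(eqP (FL _ zL)) (eqP (F'L _ zL)).
Qed.

(** The column filling has content [nu], and the content of a filling sums to the number of
    boxes. *)
Lemma card_rot_ferrers nu : is_partition nu -> #|` rot180 (ferrers nu)| = sumn nu.
Proof.
move=> nu_part; have [F FL _] := lr_fillings_surj (leqnn _) (column_filling_sst nu_part)
  (column_filling_content nu_part) (column_filling_lattice nu_part).
have [sst _ lat] := lr_fillingsP _ (leqnn _) FL.
rewrite -(sumn_shape F); congr sumn; apply/eqP.
by rewrite lr_filling_shape.
Qed.

Theorem theorem5p1 (rho kappa : seq nat)
    (rho_part : is_partition rho) (kappa_part : is_partition kappa)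
    (kappa_rho : part_sub kappa rho)
    (D_neq0 : skew_diagram rho kappa != fset0)
    (D_fat : sum_of_fat_staircases rho kappa)
    (lam mu : seq nat)
    (lam_part : is_partition lam) (mu_part : is_partition mu)
    (mu_lam : part_sub mu lam) (k : nat)
    (overlap : (nth 0%N lam 0)%:Z - (nth 0%N mu 0)%:Z - k%:Z
                 <= (last_row_length (skew_diagram rho kappa))%:Z) :
  schur_le (schur (stack lam mu (skew_diagram rho kappa) k))
    (fun n => \sum_(nu <- partitions_of #|` skew_diagram rho kappa | | fat_staircase nu)
       schur (stack lam mu (Delta (alpha nu)) k) n *+ lr_coef kappa nu rho).
Proof.
set D := skew_diagram rho kappa in D_neq0 overlap *.
case bl : (bottom_left D) => [r c].
have [footD m0] := skew_diagram_footed rho_part kappa_part D_neq0 bl.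
rewrite -/D in footD m0; set m := last_row_length D in overlap footD m0.
rewrite (stackE _ _ _ bl); set S := stack_at lam mu k D r c.
set N := (#|` D| + #|` skew_diagram lam mu|)%N.
pose S_ nu := stack_at lam mu k (rot180 (ferrers nu)) (-1) (- (nth 0%N nu 0)%:Z).
have S_E nu : nu \in partitions_of #|` D| -> fat_staircase nu ->
    stack lam mu (Delta (alpha nu)) k = S_ nu.
  rewrite mem_partitions_of => /andP[nu_part /eqP nu_sum] /andP[_ /eqP nuE].
  rewrite /Delta -nuE; apply/stackE/(footed_bottom_left (rot_ferrers_footed nu_part)).
  (* An empty [nu] would give an empty rotated diagram and the dummy corner (0, 0); it is excluded
     because [D] is nonempty. *)
  case: nu nu_sum nu_part {nuE} => [/eqP|p nu _ nu_part]; last exact: (nth_partition_gt0 (i := 0)).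
  by rewrite eq_sym cardfs_eq0 (negPf D_neq0).
have expand nu n : nu \in partitions_of #|` D| -> lr D nu != 0%N ->
    schur (S_ nu) n = \sum_(tau <- partitions_of N) schur (ferrers tau) n *+ lr (S_ nu) tau.
  rewrite mem_partitions_of => /andP[nu_part /eqP nu_sum] lr0.
  have footG := rot_ferrers_footed nu_part.
  (* The bound on the last row, applied at t = m - 1 to a filling of content [nu], gives m <= nu_0.
     So the overlap fits under the rotated diagram and the stack is convex. *)
  have le_m : (m <= nth 0%N nu 0)%N.
    have /card_gt0P[T TL] : (0 < lr D nu)%N by rewrite lt0n.
    have [sstT contT latT] := lr_fillingsP _ (leqnn _) TL.
    have [_ _ foot] := footD; have xD : (r, c + m.-1%:Z) \in D by apply: foot; lia.
    have := @bottom_row_bound _ _ _ _ _ _ _ footD sstT latT contT [` xD] m.-1.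
    by move=> /(_ _ erefl erefl); lia.
  rewrite schur_expansion ?(card_stack_at lam mu k footG) ?card_rot_ferrers ?nu_sum //.
  by apply: (stack_at_convex footG lam_part mu_part); lia.
pose C tau := (\sum_(nu <- partitions_of #|` D| | fat_staircase nu) lr D nu * lr (S_ nu) tau)%N.
have C_ge tau : (lr S tau <= C tau)%N.
  apply: leq_trans (lr_stack_le tau lam_part mu_part footD overlap) _.
  rewrite (bigID fat_staircase) /= [X in (_ + X)%N]big_seq_cond [X in (_ + X)%N]big1 ?addn0 //.
  by move=> nu /andP[nuP nfat]; rewrite (lr_not_fat rho_part kappa_part D_fat nuP nfat).
have perm_P : perm_eq [fset nu in partitions_of N] (partitions_of N).
  by apply: uniq_perm; rewrite ?fset_uniq ?partitions_of_uniq // => nu; rewrite inE.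
(* The coefficients of the difference: [C] collects those of the right-hand side, and [C_ge] makes
   the difference nonnegative. *)
exists [fset nu in partitions_of N], (fun tau => (C tau)%:Z - (lr S tau)%:Z); split.
- by move=> nu; rewrite inE mem_partitions_of => /andP[].
- by move=> nu _; rewrite subr_ge0 lez_nat.
move=> n; rewrite (perm_big _ perm_P) /=.
transitivity (\sum_(tau <- partitions_of N) schur (ferrers tau) n *+ C tau
  - \sum_(tau <- partitions_of N) schur (ferrers tau) n *+ lr S tau).
  congr (_ - _); last first.
    rewrite schur_expansion ?(card_stack_at lam mu k footD) //.
    exact: (stack_at_convex footD lam_part mu_part).
  transitivity (\sum_(nu <- partitions_of #|` D| | fat_staircase nu)
    \sum_(tau <- partitions_of N) schur (ferrers tau) n *+ (lr D nu * lr (S_ nu) tau)).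
    rewrite big_seq_cond [RHS]big_seq_cond; apply: eq_bigr => nu /andP[nuP fat].
    (* Terms with coefficient 0 are discarded first, as [expand] covers only those [nu] for which
       [D] has a Littlewood-Richardson filling. *)
    rewrite S_E // lr_coefE -/D; have [->|lr0] := eqVneq (lr D nu) 0%N.
      by rewrite mulr0n big1.
    rewrite expand // -sumrMnl; apply: eq_bigr => tau _.
    by rewrite -mulrnA mulnC.
  by rewrite exchange_big; apply: eq_bigr => tau _; rewrite -sumrMnr.
rewrite -sumrB; apply: eq_bigr => tau _.
by rewrite scalerBl -!natz !scaler_nat.
Qed.
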